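(* Let $(G,o)$ be an infinite connected edge-weighted unimodular random graph with bounded degrees and with all edge weights lying in $[w_{\min},w_{\max}]$ for some $0<w_{\min}\le w_{\max}$. If $x>0$ satisfies $\mu_G(x,\infty)=0$, then $\mu_G(\{x\})=0$.
   Context: Graphs are undirected and simple. An edge-weighted graph has a real weight $w(u,v)=w(v,u)$ on each edge $uv$ ($w(u,v)=0$ if $uv$ is not an edge); degree, distance and connectivity refer to the underlying unweighted graph. A random rooted edge-weighted graph $(G,o)$ is a Borel random element of the space of isomorphism classes (root- and weight-preserving) of locally finite rooted edge-weighted graphs (which may be taken connected, since only the component of the root matters) with the local topology, under which rooted graphs are close when large balls around the roots are isomorphic (with close weights). It is unimodular if the mass transport principle holds: for every nonnegative Borel function $f_G(x,y)$ on the space of isomorphism classes of doubly rooted edge-weighted graphs, $\mathbb{E}\sum_{x\in V(G)}f_G(o,x)=\mathbb{E}\sum_{x\in V(G)}f_G(x,o)$. Properties of $G$ (connected, infinite, degree and weight bounds by deterministic constants) hold almost surely. $A_G$ is the bounded self-adjoint operator on $\ell^2(V(G))$ given by $(A_G\psi)(x)=\sum_y w(x,y)\psi(y)$; $P^G_E$ denotes its spectral projection for Borel $E\subseteq\mathbb{R}$, and the spectral distribution is the probability measure $\mu_G(E)=\mathbb{E}\langle 1_o,P^G_E1_o\rangle$. We write $\mu_G(x,\infty)$ for $\mu_G((x,\infty))$. *)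

(* Defs.v *)
From HB Require Import structures.
From mathcomp Require Import all_boot all_order all_algebra.
From mathcomp Require Import generic_quotient finmap.
From mathcomp Require Import all_classical all_reals all_analysis.
From mathcomp Require Import measurable_realfun.
Set Implicit Arguments.
Unset Strict Implicit.
Unset Printing Implicit Defensive.
Import Order.TTheory GRing.Theory Num.Theory.
Import numFieldNormedType.Exports.
Local Open Scope quotient_scope.
Local Open Scope classical_set_scope.
Local Open Scope ring_scope.

(* A connected locally finite graph is countable, so up to isomorphism its
   vertices may be taken in nat. *)
Record wgraph (R : realType) := WGraph {
  vset : set nat;
  adj : rel nat;
  wt : nat -> nat -> R;
  adj_vset : forall x y, adj x y -> vset x /\ vset y;
  adj_irr : irreflexive adj;
  adj_sym : symmetric adj;
  wt_sym : forall x y, wt x y = wt y x;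
  wt_nadj : forall x y, ~~ adj x y -> wt x y = 0;
  adj_finite : forall x, finite_set [set y | adj x y];
  adj_connected : forall x y, vset x -> vset y ->
    exists p : seq nat, path adj x p /\ last x p = y }.

Definition degree (R : realType) (G : wgraph R) (x : nat) : nat :=
  #|` fset_set [set y | adj G x y] |.

Definition dist_le (R : realType) (G : wgraph R) (x y r : nat) : Prop :=
  exists p : seq nat, [/\ path (adj G) x p, last x p = y & (size p <= r)%N].

(* Graphs with k distinguished vertices: k = 1 gives rooted graphs and k = 2
   doubly rooted ones. *)
Record rooted_graph (R : realType) (k : nat) := RootedGraph {
  graph_of :> wgraph R;
  roots : k.-tuple (vset graph_of) }.

Definition root_of (R : realType) (k : nat) (G : rooted_graph R k) (i : 'I_k) : nat :=
  val (tnth (roots G) i).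

Definition rooted_iso (R : realType) (k : nat) (G H : rooted_graph R k) : Prop :=
  exists phi : nat -> nat,
    [/\ set_bij (vset G) (vset H) phi,
        forall i, phi (root_of G i) = root_of H i,
        forall x y, vset G x -> vset G y -> adj H (phi x) (phi y) = adj G x y
      & forall x y, vset G x -> vset G y -> wt H (phi x) (phi y) = wt G x y].

Lemma rooted_iso_refl (R : realType) (k : nat) (G : rooted_graph R k) :
  rooted_iso G G.
Proof.
by exists id; split=> //; split=> [x|x y _ _|x Gx] //; exists x.
Qed.

Lemma rooted_iso_sym (R : realType) (k : nat) (G H : rooted_graph R k) :
  rooted_iso G H -> rooted_iso H G.
Proof.
case=> phi [[phiV phi_inj phi_surj] phir phia phiw].
pose psi y := xget 0%N [set x | vset G x /\ phi x = y].
have psiP y : vset H y -> vset G (psi y) /\ phi (psi y) = y.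
  move=> /phi_surj[x Gx xy].
  by apply: (@xgetPex _ 0%N [set z | vset G z /\ phi z = y] _); exists x.
have psiK x : vset G x -> psi (phi x) = x.
  move=> Gx; have [Gp pE] := psiP _ (phiV _ Gx).
  by apply: phi_inj => //; rewrite inE.
have rootV i : vset G (root_of G i) by apply: set_mem; exact: valP.
exists psi; split.
- split.
  + by move=> y /psiP[].
  + move=> y z /set_mem/psiP[_ {2}<-] /set_mem/psiP[_ {2}<-].
    by move=> ->.
  + by move=> x Gx; exists (phi x); [exact: phiV|exact: psiK].
- by move=> i; rewrite -phir psiK.
- by move=> x y /psiP[Gx ex] /psiP[Gy ey]; rewrite -phia// ex ey.
- by move=> x y /psiP[Gx ex] /psiP[Gy ey]; rewrite -phiw// ex ey.
Qed.

Lemma rooted_iso_trans (R : realType) (k : nat) (G H K : rooted_graph R k) :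
  rooted_iso G H -> rooted_iso H K -> rooted_iso G K.
Proof.
case=> phi [bphi phir phia phiw] [psi [bpsi psir psia psiw]].
have phiV x : vset G x -> vset H (phi x) by case: bphi => + _ _; apply.
exists (psi \o phi); split.
- exact: set_bij_comp bphi bpsi.
- by move=> i /=; rewrite phir psir.
- by move=> x y Gx Gy /=; rewrite psia ?phia//; exact: phiV.
- by move=> x y Gx Gy /=; rewrite psiw ?phiw//; exact: phiV.
Qed.

HB.instance Definition _ (R : realType) (k : nat) := gen_eqMixin (rooted_graph R k).
HB.instance Definition _ (R : realType) (k : nat) :=
  gen_choiceMixin (rooted_graph R k).

Definition rooted_isob (R : realType) (k : nat) : rel (rooted_graph R k) :=
  fun G H => `[< rooted_iso G H >].

Lemma rooted_isob_class (R : realType) (k : nat) :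
  equiv_class_of (@rooted_isob R k).
Proof.
split=> [G|G H|H G K]; first by apply/asboolP; exact: rooted_iso_refl.
- by apply/asboolP/asboolP => /rooted_iso_sym.
- by move=> /asboolP GH /asboolP HK; apply/asboolP; exact: rooted_iso_trans HK.
Qed.

Canonical rooted_isob_equiv (R : realType) (k : nat) :=
  EquivRelPack (@rooted_isob_class R k).

Definition gclass (R : realType) (k : nat) : Type :=
  {eq_quot (@rooted_isob R k)}.

HB.instance Definition _ (R : realType) (k : nat) :=
  Choice.copy (gclass R k) {eq_quot (@rooted_isob R k)}.

Definition to_class (R : realType) (k : nat) (G : rooted_graph R k) : gclass R k :=
  \pi_({eq_quot (@rooted_isob R k)})%qT G.

Definition of_class (R : realType) (k : nat) (g : gclass R k) : rooted_graph R k :=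
  repr (g : {eq_quot (@rooted_isob R k)}).

(* Pointedness is only needed to make gclass a measurable type; the point is
   the one-vertex graph. *)
Program Definition one_vertex (R : realType) : wgraph R :=
  @WGraph R [set 0%N] (fun _ _ => false) (fun _ _ => 0) _ _ _ _ _ _ _.
Next Obligation. by []. Qed.
Next Obligation. by move=> R x. Qed.
Next Obligation. by move=> R x y. Qed.
Next Obligation. by []. Qed.
Next Obligation. by []. Qed.
Next Obligation.
move=> R x /=; rewrite (_ : [set _ | _] = set0); first exact: finite_set0.
by apply/seteqP; split.
Qed.
Next Obligation. by move=> R x y /= -> ->; exists [::]. Qed.

Definition one_vertex_root (R : realType) : vset (one_vertex R) :=
  exist _ 0%N (mem_set (erefl 0%N)).

HB.instance Definition _ (R : realType) (k : nat) :=
  isPointed.Build (gclass R k)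
    (to_class (@RootedGraph R k (one_vertex R) [tuple one_vertex_root R | _ < k])).

Definition ball_around (R : realType) (k : nat) (G : rooted_graph R k) (r : nat) :
    set nat :=
  [set x | exists i, dist_le G (root_of G i) x r].

(* The balls of radius r around the roots (as induced subgraphs) are
   isomorphic, with weights agreeing up to e. *)
Definition balls_close (R : realType) (k : nat) (r : nat) (e : R)
    (G H : rooted_graph R k) : Prop :=
  exists phi : nat -> nat,
    [/\ set_bij (ball_around G r) (ball_around H r) phi,
        forall i, phi (root_of G i) = root_of H i,
        forall x y, ball_around G r x -> ball_around G r y ->
          adj H (phi x) (phi y) = adj G x y
      & forall x y, ball_around G r x -> ball_around G r y ->
          `|wt H (phi x) (phi y) - wt G x y| < e].

Definition local_open (R : realType) (k : nat) : set (set (gclass R k)) :=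
  [set U | forall G : rooted_graph R k, U (to_class G) ->
    exists r : nat, exists2 e : R, 0 < e &
      forall H : rooted_graph R k, balls_close r e G H -> U (to_class H)].

Definition gspace (R : realType) (k : nat) :
    measurableType (@local_open R k).-sigma :=
  g_sigma_algebraType (@local_open R k).

Definition rooted2 (R : realType) (G : wgraph R) (x y : vset G) : rooted_graph R 2 :=
  RootedGraph [tuple x; y].

Definition the_root (R : realType) (G : rooted_graph R 1) : vset G :=
  tnth (roots G) ord0.

Definition unimodular (d : measure_display) (Omega : measurableType d)
    (R : realType) (Pr : probability Omega R)
    (g : {mfun Omega >-> gspace R 1}) : Prop :=
  forall f : gspace R 2 -> \bar R,
    measurable_fun [set: gspace R 2] f -> (forall p, (0 <= f p)%E) ->
    (\int[Pr]_w (\esum_(x in [set: vset (of_class (g w))])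
        f (to_class (rooted2 (the_root (of_class (g w))) x))) =
     \int[Pr]_w (\esum_(x in [set: vset (of_class (g w))])
        f (to_class (rooted2 x (the_root (of_class (g w)))))))%E.

(* Real l^2(V(G)), as functions on nat vanishing off V(G). *)
Definition l2 (R : realType) (G : wgraph R) : set (nat -> R) :=
  [set psi : nat -> R | (forall x, ~ vset G x -> psi x = 0) /\
             cvgn (series (fun x => psi x ^+ 2))].

Definition dotl2 (R : realType) (phi psi : nat -> R) : R :=
  limn (series (fun x => phi x * psi x)).

Definition unit_vec (R : realType) (x : nat) : nat -> R :=
  fun y => (x == y)%:R.

Definition adj_op (R : realType) (G : wgraph R) (psi : nat -> R) : nat -> R :=
  fun x => \sum_(y \in [set y | adj G x y]) wt G x y * psi y.

Definition bounded_adj_op (R : realType) (G : wgraph R) : Prop :=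
  exists M : R, forall psi : nat -> R, l2 G psi ->
    l2 G (adj_op G psi) /\
    dotl2 (adj_op G psi) (adj_op G psi) <= M * dotl2 psi psi.

(* P is the projection-valued measure of A_G: a (weakly) countably additive
   family of orthogonal projections with P(R) = 1 and A_G = int t dP(t).  As
   all operators involved are symmetric, additivity and the integral formula
   are expressed through the quadratic forms. *)
Record is_spectral_measure (R : realType) (G : wgraph R)
    (P : set R -> (nat -> R) -> (nat -> R)) : Prop := IsSpectralMeasure {
  spec_l2 : forall E psi, measurable E -> l2 G psi -> l2 G (P E psi);
  spec_linear : forall E (a : R) phi psi, measurable E -> l2 G phi ->
    l2 G psi -> P E (a *: phi + psi) = a *: P E phi + P E psi;
  spec_sym : forall E phi psi, measurable E -> l2 G phi -> l2 G psi ->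
    dotl2 phi (P E psi) = dotl2 (P E phi) psi;
  spec_idem : forall E psi, measurable E -> l2 G psi ->
    P E (P E psi) = P E psi;
  spec_setT : forall psi, l2 G psi -> P setT psi = psi;
  spec_integral : forall psi, l2 G psi ->
    exists m : {measure set R -> \bar R},
      [/\ forall E, measurable E -> m E = (dotl2 psi (P E psi))%:E,
          m.-integrable setT (fun t : R => t%:E)
        & (dotl2 psi (adj_op G psi))%:E = (\int[m]_t t%:E)%E] }.

(* The family G |-> P^G of spectral projections.  By the spectral theorem it
   exists and, for each G with A_G bounded, is determined on Borel sets and
   l^2(V(G)); its other values are irrelevant. *)
Definition spectral_proj (R : realType) :
    wgraph R -> set R -> (nat -> R) -> (nat -> R) :=
  xget (fun _ _ _ _ => 0)
    [set P | forall G, bounded_adj_op G -> is_spectral_measure G (P G)].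

Definition spectral_dist (d : measure_display) (Omega : measurableType d)
    (R : realType) (Pr : probability Omega R)
    (g : {mfun Omega >-> gspace R 1}) (E : set R) : \bar R :=
  (\int[Pr]_w
     let G := of_class (g w) in
     let one_o := unit_vec R (val (the_root G)) in
     (dotl2 one_o (spectral_proj G E one_o))%:E)%E.

(* Main.v *)
(* If the spectral projection of A_G at the top x of the spectrum were nonzero,
   Perron-Frobenius would give a positive l^2 eigenvector psi, unique up to a
   scalar, since |psi| maximizes the quadratic form whenever psi does and G is
   connected.  Normalize psi and let every vertex u send mass psi(v)^2 to every
   vertex v: the root sends total mass 1, but receives psi(o)^2 from each of
   infinitely many vertices, against the mass transport principle.

   Measurability is obtained by expressing everything through walks.  Let
   B = A + c with c large enough that B >= 0, and y = x + c.  The diagonal entry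
   (B^n)(o,o) is a continuous function of (G,o) in the local topology; it is at
   most y^n up to an error controlled by P((x,oo)), and (B^n)(v,v) / y^n
   decreases to psi(v)^2, the limit being a rank one kernel L(u,v) whose rows are
   nonnegative eigenvectors of B. *)
Require Import Defs.
From mathcomp Require Import all_boot all_order all_algebra finmap.
From mathcomp Require Import all_classical all_reals all_analysis.
From mathcomp Require Import measurable_realfun.
From mathcomp Require Import lra.
Import Order.TTheory GRing.Theory Num.Theory.
Import numFieldNormedType.Exports.
Local Open Scope classical_set_scope.
Local Open Scope ring_scope.
Set Implicit Arguments.
Unset Strict Implicit.
Unset Printing Implicit Defensive.

(** * Square summable sequences *)

(** The assumption on the spectral distribution controls a single vector, that of the root.
    Connectivity spreads it: a = (B^k)(o,v) is positive for some k, so a B^n 1_v is dominated, entry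
    by entry, by B^(n+k) 1_o, and every finitely supported vector grows at rate at most y under B.
    Log-convexity then turns a growth rate, whose constant depends on the vector, into the uniform
    bound |B u| <= y |u| on all of l^2. The shift is c = D W, for D a bound on degrees and W on
    weights. By Schur's test it dominates the norm of A, so B is positive semidefinite besides
    having nonnegative entries, and <u, B^n u> / y^n is monotone over all n, not only over even n.
    The kernel L spares the measurable choice of an eigenvector: only the entries L(v,v) are
    transported, and their sum is at most 1 because L has rank one. The spectral masses <1_o, P 1_o>
    are never shown to be measurable in the random graph. They are compared almost everywhere with
    walk weights, and the integral of a nonnegative function, a supremum over simple functions, is
    monotone all the same. *)

Definition subspace_set (R : realType) (V : lmodType R) (S : set V) : Prop :=
  S 0 /\ forall (a : R) (u v : V), S u -> S v -> S (a *: u + v).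

Lemma subspace_scale (R : realType) (V : lmodType R) (S : set V) (a : R) u :
  subspace_set S -> S u -> S (a *: u).
Proof. by move=> [S0 SD] Su; rewrite -[_ *: _]addr0; exact: SD. Qed.

(** The discriminant of a |-> q(a u + v, a u + v). Stated for semidefinite forms, as it serves not
    only for the dot product but also for <T u, v> and y <u, v> - <T u, v>. *)
Lemma psd_cauchy_schwarz (R : realType) (V : lmodType R) (S : set V)
    (q : V -> V -> R) : subspace_set S ->
  (forall a u v w, S u -> S v -> S w -> q (a *: u + v) w = a * q u w + q v w) ->
  (forall u v, S u -> S v -> q u v = q v u) -> (forall u, S u -> 0 <= q u u) ->
  forall u v, S u -> S v -> q u v ^+ 2 <= q u u * q v v.
Proof.
move=> [_ SD] qlin qC q0 u v Su Sv.
have quad (a : R) : 0 <= a ^+ 2 * q u u + 2 * a * q u v + q v v.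
  have Sw := SD a _ _ Su Sv.
  have := q0 _ Sw; rewrite qlin// (qC u)// (qC v)// !qlin// (qC v u)//.
  by move=> h; lra.
have [uu0|uu0] := eqVneq (q u u) 0.
  have [->|uv0] := eqVneq (q u v) 0; first by rewrite expr0n/= mulr_ge0 ?q0.
  (* The quadratic is affine in a here, and this a gives it the value -1. *)
  have := quad (- (q v v + 1) / 2 / q u v).
  by rewrite uu0 mulr0 add0r (mulrA 2) divfK// mulrCA divff ?pnatr_eq0// mulr1; lra.
have upos : 0 < q u u by rewrite lt_neqAle eq_sym uu0 q0.
have := quad (- q u v / q u u).
rewrite -(pmulr_rge0 _ upos) !mulrDr.
set r := _ / _; have rE : q u u * r = - q u v by rewrite mulrC divfK.
rewrite -subr_ge0 (_ : _ + _ = (q u u * r) ^+ 2 + 2 * (q u u * r) * q u v + q u u * q v v); last by lra.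
by rewrite rE; lra.
Qed.

Lemma cvg_sum_seq (R : realType) (T : Type) (F : set_system T) (FF : Filter F)
    (I : eqType) (r : seq I) (f : I -> T -> R) (a : I -> R) :
  (forall i, i \in r -> f i @ F --> a i) ->
  (fun t => \sum_(i <- r) f i t) @ F --> \sum_(i <- r) a i.
Proof.
elim: r => [|i r IH] fa.
  by under eq_fun do rewrite big_nil; rewrite big_nil; exact: cvg_cst.
under eq_fun do rewrite big_cons; rewrite big_cons.
apply: cvgD; first by apply: fa; rewrite mem_head.
by apply: IH => j jr; apply: fa; rewrite in_cons jr orbT.
Qed.

Section SquareSummable.
Context {R : realType}.
Implicit Types phi psi : nat -> R.

Definition sqsum : set (nat -> R) :=
  [set psi : nat -> R | cvgn (series (fun x => psi x ^+ 2))].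

Lemma nneg_series_bounded (a : nat -> R) (M : R) : (forall x, 0 <= a x) ->
  (forall n, series a n <= M) -> cvgn (series a) /\ limn (series a) <= M.
Proof.
move=> a0 aM.
have nd : nondecreasing_seq (series a).
  by apply/nondecreasing_seqP => n; rewrite seriesSr lerDl.
have cv : cvgn (series a).
  by apply: nondecreasing_is_cvgn => //; exists M => _ [n _ <-].
by split=> //; apply: limr_le => //; apply: nearW.
Qed.

Lemma nneg_series_le_lim (a : nat -> R) n : (forall x, 0 <= a x) ->
  cvgn (series a) -> series a n <= limn (series a).
Proof.
move=> a0 cv; apply: nondecreasing_cvgn_le => //.
by apply/nondecreasing_seqP => k; rewrite seriesSr lerDl.
Qed.

Lemma sqsum_bounded psi (M : R) :
  (forall n, series (fun x => psi x ^+ 2) n <= M) ->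
  sqsum psi /\ dotl2 psi psi <= M.
Proof. by move=> /nneg_series_bounded; apply=> x; exact: sqr_ge0. Qed.

Lemma series_sqr_le_dotl2 psi n : sqsum psi ->
  series (fun x => psi x ^+ 2) n <= dotl2 psi psi.
Proof. by apply: nneg_series_le_lim => x; exact: sqr_ge0. Qed.

Lemma sqsum_le phi psi : (forall x, `|phi x| <= `|psi x|) -> sqsum psi ->
  sqsum phi /\ dotl2 phi phi <= dotl2 psi psi.
Proof.
move=> le sp; apply: sqsum_bounded => n.
apply: le_trans (series_sqr_le_dotl2 n sp).
apply: ler_sum => i _.
by rewrite -(real_normK (num_real (phi i))) -(real_normK (num_real (psi i))) lerXn2r ?nnegrE.
Qed.

Lemma sqsum_mul phi psi : sqsum phi -> sqsum psi ->
  cvgn (series (fun x => phi x * psi x)).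
Proof.
move=> sf sp; apply: normed_cvg.
apply: (@series_le_cvg _ _ (fun x => phi x ^+ 2 + psi x ^+ 2)) => [n|n|n|].
- exact: normr_ge0.
- by rewrite addr_ge0 ?sqr_ge0.
- by rewrite ler_norml; apply/andP; split; nra.
- by apply: is_cvg_seriesD.
Qed.

Lemma dotl2C phi psi : dotl2 phi psi = dotl2 psi phi.
Proof. by rewrite /dotl2; congr (limn (series _)); apply/funext => x; rewrite mulrC. Qed.

Lemma sqsumD (a : R) phi psi : sqsum phi -> sqsum psi -> sqsum (a *: phi + psi).
Proof.
move=> sf sp.
have c1 := is_cvg_seriesZ (k := a ^+ 2) sf.
have c2 := is_cvg_seriesZ (k := 2 * a) (sqsum_mul sf sp).
rewrite /sqsum /= (_ : (fun x => _) = (a ^+ 2 *: (fun x => phi x ^+ 2) +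
  (2 * a) *: (fun x => phi x * psi x)) + (fun x => psi x ^+ 2)).
  by apply: is_cvg_seriesD => //; apply: is_cvg_seriesD.
apply/funext => x.
change ((a * phi x + psi x) ^+ 2 =
  (a ^+ 2 * (phi x ^+ 2) + (2 * a) * (phi x * psi x)) + psi x ^+ 2).
by lra.
Qed.

Lemma sqsum0 : sqsum 0.
Proof.
by apply: (@sqsum_bounded _ 0 _).1 => n; rewrite /series/= big1// => i _; rewrite expr0n.
Qed.

Lemma sqsum_subspace : subspace_set sqsum.
Proof. by split; [exact: sqsum0|exact: sqsumD]. Qed.

Lemma dotl2Dl (a : R) u v w : sqsum u -> sqsum v -> sqsum w ->
  dotl2 (a *: u + v) w = a * dotl2 u w + dotl2 v w.
Proof.
move=> su sv sw; rewrite /dotl2.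
have c1 := sqsum_mul su sw; have c2 := sqsum_mul sv sw.
rewrite (_ : (fun x => _) = a *: (fun x => u x * w x) + (fun x => v x * w x)).
  by rewrite lim_seriesD//; [rewrite lim_seriesZ|apply: is_cvg_seriesZ].
apply/funext => x.
change ((a * u x + v x) * w x = a * (u x * w x) + v x * w x); by lra.
Qed.

Lemma dotl2Dr (a : R) u v w : sqsum u -> sqsum v -> sqsum w ->
  dotl2 w (a *: u + v) = a * dotl2 w u + dotl2 w v.
Proof. by move=> *; rewrite dotl2C dotl2Dl// ![dotl2 w _]dotl2C. Qed.

Lemma dotl2_ge0 u : sqsum u -> 0 <= dotl2 u u.
Proof.
move=> su; apply: le_trans (series_sqr_le_dotl2 0%N su).
by rewrite /series/= big_geq.
Qed.

Lemma sqr_le_dotl2 u x : sqsum u -> u x ^+ 2 <= dotl2 u u.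
Proof.
move=> su; apply: le_trans (series_sqr_le_dotl2 x.+1 su).
by rewrite seriesSr lerDr /series/= sumr_ge0// => i _; exact: sqr_ge0.
Qed.

Lemma sum_sqr_le_dotl2 u (X : seq nat) : sqsum u -> uniq X ->
  \sum_(z <- X) u z ^+ 2 <= dotl2 u u.
Proof.
move=> su uX; have [N XN] : exists N, forall x, x \in X -> (x < N)%N.
  exists (\max_(y <- X) y).+1 => x xX; rewrite ltnS.
  exact: (@leq_bigmax_seq _ _ _ id).
apply: le_trans (series_sqr_le_dotl2 N su).
rewrite /series/= [leRHS](bigID [in X])/= -[leLHS]addr0 lerD//; last first.
  by apply: sumr_ge0 => i _; exact: sqr_ge0.
rewrite -[leRHS]big_filter le_eqVlt; apply/orP; left; apply/eqP.
apply: perm_big; apply: uniq_perm => //.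
  by rewrite filter_uniq// iota_uniq.
move=> z; rewrite mem_filter mem_index_iota/=.
by case: (boolP (z \in X)) => // /XN ->.
Qed.

Lemma dotl2Zl (a : R) u v : sqsum u -> sqsum v -> dotl2 (a *: u) v = a * dotl2 u v.
Proof.
move=> su sv; rewrite /dotl2 -[RHS](lim_seriesZ (f := fun x => u x * v x)); last exact: sqsum_mul.
congr (limn (series _)); apply/funext => x.
by change (a * u x * v x = a * (u x * v x)); rewrite mulrA.
Qed.

Lemma dotl2Zr (a : R) u v : sqsum u -> sqsum v -> dotl2 u (a *: v) = a * dotl2 u v.
Proof. by move=> su sv; rewrite dotl2C dotl2Zl// dotl2C. Qed.

Lemma sqsumZ (a : R) u : sqsum u -> sqsum (a *: u).
Proof. by move=> su; rewrite -[_ *: _]addr0; apply: sqsumD => //; exact: sqsum0. Qed.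

Lemma dotl20 (u : nat -> R) : dotl2 0 u = 0.
Proof.
rewrite /dotl2 (_ : series _ = cst 0) ?lim_cst//; apply/funext => n.
by rewrite /series/= big1// => i _; rewrite mul0r.
Qed.

Lemma dotl2_eq0 u : sqsum u -> dotl2 u u = 0 -> u = 0.
Proof.
move=> su u0; apply/funext => x; apply/eqP; rewrite -sqrf_eq0 eq_le sqr_ge0 andbT.
by rewrite -u0 sqr_le_dotl2.
Qed.

Lemma dotl2_cauchy_schwarz u v : sqsum u -> sqsum v ->
  dotl2 u v ^+ 2 <= dotl2 u u * dotl2 v v.
Proof.
apply: (psd_cauchy_schwarz sqsum_subspace); last exact: dotl2_ge0.
- by move=> *; exact: dotl2Dl.
- by move=> *; exact: dotl2C.
Qed.

Lemma ler_dotl2 u v u' v' : sqsum u -> sqsum v -> sqsum u' -> sqsum v' ->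
  (forall x, u x * v x <= u' x * v' x) -> dotl2 u v <= dotl2 u' v'.
Proof. by move=> *; apply: lim_series_le => //; exact: sqsum_mul. Qed.

Lemma series_fin_supp (a : nat -> R) x n : (forall z, z != x -> a z = 0) ->
  (x < n)%N -> series a n = a x.
Proof.
move=> ax xn; rewrite /series/= (bigD1_seq x)/= ?mem_index_iota ?iota_uniq//.
by rewrite big1 ?addr0// => i /ax.
Qed.

Lemma lim_series_fin_supp (a : nat -> R) x : (forall z, z != x -> a z = 0) ->
  series a @ \oo --> a x.
Proof.
move=> ax; apply: cvg_near_cst; exists x.+1 => // n /= xn.
exact: series_fin_supp.
Qed.

Lemma sqsum_unit x : sqsum (@unit_vec R x).
Proof.
apply/cvg_ex; exists (unit_vec R x x ^+ 2); apply: lim_series_fin_supp => z zx.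
by rewrite /unit_vec eq_sym (negbTE zx) expr0n.
Qed.

Lemma dotl2_unitl x psi : dotl2 (unit_vec R x) psi = psi x.
Proof.
apply/cvg_lim => //; rewrite [X in _ --> X](_ : _ = unit_vec R x x * psi x).
  apply: lim_series_fin_supp => z zx.
  by rewrite /unit_vec eq_sym (negbTE zx) mul0r.
by rewrite /unit_vec eqxx mul1r.
Qed.

Lemma dotl2_unitr x psi : dotl2 psi (unit_vec R x) = psi x.
Proof. by rewrite dotl2C dotl2_unitl. Qed.

(** Fatou's lemma for the counting measure: a partial sum has finitely many terms and passes to the
    limit. *)
Lemma sqsum_fatou (u_ : nat -> nat -> R) u (M_ : nat -> R) M :
  (forall x, u_ n x @[n --> \oo] --> u x) -> (forall n, sqsum (u_ n)) ->
  (forall n, dotl2 (u_ n) (u_ n) <= M_ n) -> M_ @ \oo --> M ->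
  sqsum u /\ dotl2 u u <= M.
Proof.
move=> cv sq le cM; apply: sqsum_bounded => N.
have c : (fun n => series (fun x => u_ n x ^+ 2) N) @ \oo -->
    series (fun x => u x ^+ 2) N.
  rewrite /series/=; apply: cvg_sum_seq => i _; rewrite expr2.
  by under eq_fun do rewrite expr2; exact: cvgM.
apply: (ler_cvg_to c cM); apply: nearW => n.
by apply: le_trans (le n); exact: series_sqr_le_dotl2.
Qed.

(** The parallelogram identity, with the squared norm of v - a u dropped. *)
Lemma dotl2_add_le (a : R) u v : sqsum u -> sqsum v ->
  dotl2 (a *: u + v) (a *: u + v) <= 2 * a ^+ 2 * dotl2 u u + 2 * dotl2 v v.
Proof.
move=> su sv; have := dotl2_ge0 (sqsumD (a := - a) su sv).
rewrite !dotl2Dl ?dotl2Dr//; last 2 first.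
- exact: sqsumD.
- exact: sqsumD.
by rewrite [dotl2 v u]dotl2C; lra.
Qed.

Lemma sqsum_abs (u : nat -> R) : sqsum u -> sqsum (fun x => `|u x|).
Proof. by move=> su; apply: (@sqsum_le _ u _ su).1 => x; rewrite normr_id. Qed.

Lemma dotl2_abs (u : nat -> R) : dotl2 (fun x => `|u x|) (fun x => `|u x|) = dotl2 u u.
Proof.
rewrite /dotl2; congr (limn (series _)); apply/funext => x.
by rewrite -!expr2 real_normK ?num_real.
Qed.

End SquareSummable.

(** * Symmetric operators *)

(** Relative to a set [S], because the theory is applied to [l2 G] and also to ranges and kernels of
    spectral projections, where sharper bounds hold. *)
Record symmetric_op (R : realType) (S : set (nat -> R))
    (T : (nat -> R) -> (nat -> R)) : Prop := SymmetricOp {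
  symop_stable : forall u, S u -> S (T u);
  symop_linear : forall (a : R) u v, S u -> S v ->
    T (a *: u + v) = a *: T u + T v;
  symop_sym : forall u v, S u -> S v -> dotl2 (T u) v = dotl2 u (T v) }.

(** By Bernoulli's inequality the powers of some r > 1 would be unbounded. *)
Lemma expr_bounded_le1 (R : realType) (r C : R) : 0 <= r ->
  (forall n, r ^+ n <= C) -> r <= 1.
Proof.
move=> r0 rC; rewrite leNgt; apply/negP => r1.
have bern n : 1 + n%:R * (r - 1) <= r ^+ n.
  elim: n => [|n IH]; first by rewrite mul0r addr0 expr0.
  have n0 : 0 <= n%:R * (r - 1) * (r - 1) by rewrite !mulr_ge0 ?ler0n// subr_ge0 ltW.
  rewrite exprS -natr1; apply: le_trans (ler_wpM2l r0 IH).
  by move: n0; set m := n%:R; lra.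
have d0 : 0 < r - 1 by rewrite subr_gt0.
have [n nC] : exists n : nat, C / (r - 1) < n%:R.
  exists (Num.truncn (C / (r - 1))).+1; exact: truncnS_gt.
have := le_trans (bern n) (rC n).
by move: nC; rewrite ltr_pdivrMr//; lra.
Qed.

Section SymmetricOperator.
Context {R : realType} (S : set (nat -> R)) (T : (nat -> R) -> (nat -> R)).
Hypothesis S_sub : subspace_set S.
Hypothesis S_sq : S `<=` sqsum.
Hypothesis T_sym : symmetric_op S T.
Implicit Types u v w : nat -> R.

Lemma iter_stable n u : S u -> S (iter n T u).
Proof. by move=> Su; elim: n => //= n IH; exact: symop_stable T_sym _ IH. Qed.

Lemma iter_sym n u v : S u -> S v ->
  dotl2 (iter n T u) v = dotl2 u (iter n T v).
Proof.
move=> Su Sv; elim: n => //= n IH in v Sv *.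
rewrite (symop_sym T_sym)//; last exact: iter_stable.
by rewrite IH -?iterS ?iterSr//; exact: symop_stable T_sym _ Sv.
Qed.

Lemma iter_linear n (a : R) u v : S u -> S v ->
  iter n T (a *: u + v) = a *: iter n T u + iter n T v.
Proof.
move=> Su Sv; elim: n => //= n ->.
by rewrite (symop_linear T_sym)//; exact: iter_stable.
Qed.

Lemma dotl2_iterD m n u v : S u -> S v ->
  dotl2 (iter m T u) (iter n T v) = dotl2 u (iter (m + n) T v).
Proof. by move=> Su Sv; rewrite iter_sym ?iterD//; exact: iter_stable. Qed.

(* n |-> |T^n u|^2 is log-convex, so its first ratio is at most its exponential
   growth rate. *)
Lemma growth_bound (y C : R) u : 0 < y -> S u ->
  (forall n, dotl2 (iter n T u) (iter n T u) <= C * (y ^+ n) ^+ 2) ->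
  dotl2 (T u) (T u) <= y ^+ 2 * dotl2 u u.
Proof.
move=> y0 Su uC; pose a n := dotl2 (iter n T u) (iter n T u).
have Sn n : sqsum (iter n T u) by apply/S_sq/iter_stable.
have a0 n : 0 <= a n by exact: dotl2_ge0.
have aconv n : a n.+1 ^+ 2 <= a n * a n.+2.
  rewrite /a [dotl2 (iter n.+1 T u) _](_ : _ = dotl2 (iter n T u) (iter n.+2 T u)).
    exact: dotl2_cauchy_schwarz.
  by rewrite !dotl2_iterD// addSnnS.
have [uu0|uu0] := eqVneq (a 0%N) 0.
  have := aconv 0%N; rewrite uu0 mul0r => h.
  have /eqP : a 1%N ^+ 2 = 0 by apply/eqP; rewrite eq_le h sqr_ge0.
  rewrite sqrf_eq0 => /eqP a1; have -> : dotl2 (T u) (T u) = 0 by exact: a1.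
  by rewrite mulr_ge0 ?sqr_ge0//; exact: (a0 0%N).
have upos : 0 < a 0%N by rewrite lt_neqAle eq_sym uu0 a0.
pose r := a 1%N / a 0%N; have r0 : 0 <= r by rewrite divr_ge0.
have y20 : 0 < y ^+ 2 by rewrite exprn_gt0.
have ratio n : r * a n <= a n.+1.
  elim: n => [|n IH]; first by rewrite divfK.
  have [an0|an0] := eqVneq (a n.+1) 0; first by rewrite an0 mulr0.
  have anpos : 0 < a n.+1 by rewrite lt_neqAle eq_sym an0 a0.
  rewrite -(ler_pM2l anpos); apply: (@le_trans _ _ (a n * r * a n.+2)).
    by have := ler_wpM2l r0 (aconv n); lra.
  by rewrite ler_wpM2r// mulrC.
have geo n : r ^+ n * a 0%N <= a n.
  elim: n => [|n IH]; first by rewrite mul1r.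
  by rewrite exprS -mulrA; apply: le_trans (ratio n); exact: ler_wpM2l.
have : r / y ^+ 2 <= 1.
  apply: (@expr_bounded_le1 _ _ (C / a 0%N)); first by rewrite divr_ge0// ltW.
  move=> n; rewrite ler_pdivlMr// expr_div_n mulrAC ler_pdivrMr ?exprn_gt0//.
  by rewrite -exprM mulnC exprM; apply: le_trans (geo n) (uC n).
by rewrite ler_pdivrMr// mul1r ler_pdivrMr.
Qed.

Section Positive.
Variable y : R.
Hypothesis y_ge0 : 0 <= y.
Hypothesis T_ge0 : forall u, S u -> 0 <= dotl2 u (T u).
Hypothesis T_le : forall u, S u -> dotl2 u (T u) <= y * dotl2 u u.

(** This is T^2 <= y T. Cauchy-Schwarz for the form <T u, v> at u and T u gives |T u|^4 <= <T u, u>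
    <T T u, T u>, and the last factor is at most y |T u|^2. *)
Lemma dotl2_op_le u : S u -> dotl2 (T u) (T u) <= y * dotl2 u (T u).
Proof.
move=> Su; have STu := symop_stable T_sym Su.
have STTu := symop_stable T_sym STu.
have cs : dotl2 (T u) (T u) ^+ 2 <= dotl2 (T u) u * dotl2 (T (T u)) (T u).
  apply: (psd_cauchy_schwarz (q := fun u v => dotl2 (T u) v) S_sub) => //.
  - move=> a v w z Sv Sw Sz; rewrite (symop_linear T_sym)//.
    by apply: dotl2Dl; apply: S_sq => //; exact: symop_stable T_sym _ _.
  - by move=> v w Sv Sw; rewrite (symop_sym T_sym)// dotl2C.
  - by move=> v Sv; rewrite dotl2C T_ge0.
have := T_le STu; rewrite dotl2C => le2.
have t0 := T_ge0 Su; have tt0 := dotl2_ge0 (S_sq STu).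
have [->|n0] := eqVneq (dotl2 (T u) (T u)) 0; first exact: mulr_ge0.
have npos : 0 < dotl2 (T u) (T u) by rewrite lt_neqAle eq_sym n0 tt0.
rewrite -(ler_pM2r npos) -expr2; apply: le_trans cs _.
rewrite dotl2C -mulrA mulrCA; exact: ler_wpM2l.
Qed.

Lemma dotl2_op_le_sqr u : S u -> dotl2 (T u) (T u) <= y ^+ 2 * dotl2 u u.
Proof.
move=> Su; apply: le_trans (dotl2_op_le Su) _.
by rewrite expr2 -mulrA ler_wpM2l// T_le.
Qed.

Lemma dotl2_iter_le n u : S u ->
  dotl2 (iter n T u) (iter n T u) <= (y ^+ n) ^+ 2 * dotl2 u u.
Proof.
move=> Su; elim: n => [|n IH]; first by rewrite expr0 expr1n mul1r.
rewrite [y ^+ n.+1]exprS exprMn -mulrA; apply: le_trans (dotl2_op_le_sqr _) _.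
  exact: iter_stable.
by rewrite ler_wpM2l ?sqr_ge0.
Qed.

(** With v = T^m u and m = n./2, the n-th moment is |v|^2 for even n and <v, T v> for odd n. The
    next moment is compared with it through T <= y in the even case and T^2 <= y T in the odd
    case. *)
Lemma moment_ge0_le n u : S u -> 0 <= dotl2 u (iter n T u) /\
  dotl2 u (iter n.+1 T u) <= y * dotl2 u (iter n T u).
Proof.
move=> Su; have Sn k := iter_stable k Su.
pose m := n./2; have := odd_double_half n; rewrite -addnn -/m.
case: (odd n) => <-.
  have -> : dotl2 u (iter (true + (m + m))%N T u) =
      dotl2 (iter m T u) (T (iter m T u)) by rewrite -iterS dotl2_iterD// addnS.
  have -> : dotl2 u (iter (true + (m + m)).+1 T u) =
      dotl2 (T (iter m T u)) (T (iter m T u)) by rewrite -iterS dotl2_iterD// addSn addnS.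
  by split; [exact: T_ge0|exact: dotl2_op_le].
rewrite add0n -addnS -!dotl2_iterD//; split; last exact: T_le.
by apply/dotl2_ge0/S_sq.
Qed.

(** The semidefinite form y <u, v> - <T u, v> vanishes at (u, u), hence at (u, v) for every v, by
    Cauchy-Schwarz. *)
Lemma top_eigenvector u v : S u -> S v -> y * dotl2 u u <= dotl2 u (T u) ->
  dotl2 (T u) v = y * dotl2 u v.
Proof.
move=> Su Sv yu; pose q a b := y * dotl2 a b - dotl2 (T a) b.
have quu : q u u = 0.
  apply/eqP; rewrite subr_eq0 eq_le [dotl2 (T u) u]dotl2C yu andTb.
  exact: T_le.
have : q u v ^+ 2 <= q u u * q v v.
  apply: (psd_cauchy_schwarz S_sub) => //.
  - move=> a b c z Sb Sc Sz; rewrite /q (symop_linear T_sym)//.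
    have [[sb sc] sz] := (S_sq Sb, S_sq Sc, S_sq Sz).
    have [sTb sTc] := (S_sq (symop_stable T_sym Sb), S_sq (symop_stable T_sym Sc)).
    by rewrite !dotl2Dl//; lra.
  - by move=> b c Sb Sc; rewrite /q (symop_sym T_sym)// [dotl2 b c]dotl2C [dotl2 b _]dotl2C.
  - by move=> b Sb; rewrite /q subr_ge0 [dotl2 (T b) b]dotl2C T_le.
rewrite quu mul0r => h; apply/eqP; rewrite eq_sym -subr_eq0 -sqrf_eq0.
by rewrite eq_le h sqr_ge0.
Qed.

(** For u = v the sequence is nonincreasing and nonnegative; the general case follows by
    polarization. *)
Lemma moment_cvg u v : 0 < y -> S u -> S v ->
  cvgn (fun n => dotl2 u (iter n T v) / y ^+ n).
Proof.
move=> y0; have diag w : S w -> cvgn (fun n => dotl2 w (iter n T w) / y ^+ n).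
  move=> Sw; apply: nonincreasing_is_cvgn.
    apply/nonincreasing_seqP => n; have [_ h] := moment_ge0_le n Sw.
    rewrite ler_pdivrMr ?exprn_gt0// exprS mulrCA divfK ?gt_eqF ?exprn_gt0//.
  exists 0 => _ [n _ <-]; rewrite divr_ge0 ?exprn_ge0//.
  by have [] := moment_ge0_le n Sw.
move=> Su Sv; have Suv : S (1 *: u + v) by apply: S_sub.2.
rewrite (_ : (fun n => _) = (fun n => 2^-1 *
  (dotl2 (1 *: u + v) (iter n T (1 *: u + v)) / y ^+ n -
   dotl2 u (iter n T u) / y ^+ n - dotl2 v (iter n T v) / y ^+ n))).
  apply: is_cvgM; first exact: is_cvg_cst.
  by apply: is_cvgB; [apply: is_cvgB|]; exact: diag.
apply/funext => n; rewrite iter_linear//.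
have [su sv] := (S_sq Su, S_sq Sv).
have [tu tv] := (S_sq (iter_stable n Su), S_sq (iter_stable n Sv)).
have -> : dotl2 (1 *: u + v) (1 *: iter n T u + iter n T v) =
  dotl2 u (iter n T u) + dotl2 u (iter n T v) * 2 + dotl2 v (iter n T v).
  rewrite dotl2Dl ?dotl2Dr//; last by apply: sqsum_subspace.2.
  by rewrite -(iter_sym n Sv Su) [dotl2 (iter n T v) u]dotl2C; lra.
by set a := y ^+ n; lra.
Qed.

End Positive.
End SymmetricOperator.

(** * The adjacency operator of a graph of bounded degree *)

Section Truncation.
Context {R : realType}.
Implicit Types u v : nat -> R.

Definition truncate (N : nat) v : nat -> R := fun x => if (x < N)%N then v x else 0.

Lemma truncate0 v : truncate 0 v = 0.
Proof. by apply/funext => x; rewrite /truncate ltn0. Qed.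

Lemma truncateS N v : truncate N.+1 v = v N *: unit_vec R N + truncate N v.
Proof.
apply/funext => x.
change ((if (x < N.+1)%N then v x else 0) =
  v N * (N == x)%:R + (if (x < N)%N then v x else 0)).
by rewrite ltnS; case: (ltngtP x N) => [_|_|->]; rewrite ?mulr0 ?add0r ?mulr1 ?addr0.
Qed.

Lemma dotl2_truncatel N u v :
  dotl2 (truncate N u) v = series (fun x => u x * v x) N.
Proof.
apply/cvg_lim => //; apply: cvg_near_cst; exists N => // n /= Nn.
rewrite /series/= (@big_cat_nat _ _ _ N)//= [X in _ + X]big1_seq ?addr0.
  by apply: eq_big_nat => i /andP[_ iN]; rewrite /truncate iN.
move=> i /=; rewrite mem_index_iota => /andP[Ni _].
by rewrite /truncate ltnNge Ni mul0r.
Qed.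

Lemma sqsum_truncate N v : sqsum v -> sqsum (truncate N v).
Proof.
move=> sv; apply: (@sqsum_le _ _ v _ sv).1 => x; rewrite /truncate.
by case: ifP => //; rewrite normr0.
Qed.

Lemma truncate_cvg v x : truncate N v x @[N --> \oo] --> v x.
Proof. by apply: cvg_near_cst; exists x.+1 => // n /= xn; rewrite /truncate xn. Qed.

Lemma truncate_dist_cvg0 v : sqsum v ->
  dotl2 (v - truncate N v) (v - truncate N v) @[N --> \oo] --> (0 : R).
Proof.
move=> sv; rewrite (_ : (fun N => _) =
    fun N => dotl2 v v - series (fun x => v x ^+ 2) N).
  by rewrite -[X in _ --> X](subrr (dotl2 v v)); apply: cvgB => //; exact: cvg_cst.
apply/funext => N; have sN : sqsum (truncate N v) by exact: sqsum_truncate.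
have -> : v - truncate N v = (-1) *: truncate N v + v by rewrite scaleN1r addrC.
have sd : sqsum ((-1) *: truncate N v + v) by exact: sqsumD.
rewrite dotl2Dl// !dotl2Dr// [dotl2 v (truncate N v)]dotl2C !dotl2_truncatel.
have -> : series (fun x => v x * truncate N v x) N = series (fun x => v x * v x) N.
  by apply: eq_big_nat => i /andP[_ iN]; rewrite /truncate iN.
have -> : series (fun x => v x ^+ 2) N = series (fun x => v x * v x) N by [].
by set a := series _ _; lra.
Qed.

End Truncation.

Lemma weighted_cauchy_schwarz (R : realType) (M : nat) (w a : nat -> R) :
  (forall x, 0 <= w x) ->
  (\sum_(0 <= y < M) w y * a y) ^+ 2 <=
  (\sum_(0 <= y < M) w y) * \sum_(0 <= y < M) w y * a y ^+ 2.
Proof.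
move=> w0; pose q (u v : nat -> R) := \sum_(0 <= y < M) w y * u y * v y.
have : q (fun=> 1) a ^+ 2 <= q (fun=> 1) (fun=> 1) * q a a.
  apply: (psd_cauchy_schwarz (S := setT)) => //.
  - move=> c u v z _ _ _; rewrite /q mulr_sumr -big_split/=.
    apply: eq_bigr => i _.
    change (w i * (c * u i + v i) * z i = c * (w i * u i * z i) + w i * v i * z i).
    by lra.
  - by move=> u v _ _; apply: eq_bigr => i _; rewrite mulrAC.
  - by move=> u _; apply: sumr_ge0 => i _; rewrite -mulrA mulr_ge0 ?w0// -expr2 sqr_ge0.
rewrite /q; under eq_bigr do rewrite mulr1.
under [in X in _ <= X -> _]eq_bigr do rewrite !mulr1.
by under [X in _ <= _ * X -> _]eq_bigr do rewrite -mulrA -expr2.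
Qed.

Section GraphOperator.
Context {R : realType}.
Variable G : wgraph R.
Implicit Types u v psi : nat -> R.

Lemma l2_sqsum : l2 G `<=` sqsum.
Proof. by move=> psi []. Qed.

Lemma l2_subspace : subspace_set (l2 G).
Proof.
split; first by split => //; exact: sqsum0.
move=> a u v [u0 su] [v0 sv]; split; last exact: sqsumD.
move=> x Gx; change (a * u x + v x = 0).
by rewrite u0// v0// mulr0 addr0.
Qed.

Lemma l2_unit x : vset G x -> l2 G (unit_vec R x).
Proof.
move=> Gx; split; last exact: sqsum_unit.
by move=> y Gy; rewrite /unit_vec; case: eqVneq => // xy; rewrite xy in Gx.
Qed.

Lemma l2_truncate N u : l2 G u -> l2 G (truncate N u).
Proof.
move=> [u0 su]; split; last exact: sqsum_truncate.
by move=> x /u0; rewrite /truncate => ->; case: ifP.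
Qed.

Lemma l2_abs u : l2 G u -> l2 G (fun x => `|u x|).
Proof. by move=> [u0 su]; split; [move=> x /u0 ->; rewrite normr0|exact: sqsum_abs]. Qed.

Definition nbrs x := fset_set [set y | adj G x y].

Lemma in_nbrs x y : (y \in nbrs x) = adj G x y.
Proof.
rewrite in_fset_set; last exact: adj_finite.
by apply/idP/idP; rewrite inE.
Qed.

Lemma adj_opE psi x : adj_op G psi x = \sum_(y <- nbrs x) wt G x y * psi y.
Proof. by rewrite /adj_op fsbig_finite//; exact: adj_finite. Qed.

(** Rows written over an initial segment of [nat], which can be the same for finitely many x, so
    that double sums can be exchanged. *)
Lemma adj_op_nat psi x M : (forall y, adj G x y -> (y < M)%N) ->
  adj_op G psi x = \sum_(0 <= y < M) wt G x y * psi y.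
Proof.
move=> xM; rewrite adj_opE [RHS](bigID (adj G x))/= [X in _ + X]big1 ?addr0.
  rewrite -[RHS]big_filter; apply: perm_big; apply: uniq_perm.
  - exact: fset_uniq.
  - by rewrite filter_uniq// iota_uniq.
  move=> y; rewrite in_nbrs mem_filter mem_index_iota/=.
  by case: (boolP (adj G x y)) => // /xM ->.
by move=> y /(@wt_nadj _ G) ->; rewrite mul0r.
Qed.

Lemma nbrs_bound x : exists M, forall y, adj G x y -> (y < M)%N.
Proof.
exists (\max_(y <- nbrs x) y).+1 => y; rewrite -in_nbrs => yx; rewrite ltnS.
exact: (@leq_bigmax_seq _ _ _ id).
Qed.

Lemma nbrs_bound_lt N : exists M, forall x, (x < N)%N ->
  forall y, adj G x y -> (y < M)%N.
Proof.
elim: N => [|N [M IH]]; first by exists 0%N.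
have [M' h] := nbrs_bound N; exists (maxn M M') => x; rewrite ltnS leq_eqVlt.
case/orP => [/eqP->|xN] y xy; rewrite leq_max.
  by rewrite h ?orbT.
by rewrite (IH _ xN _ xy).
Qed.

Lemma adj_op_linear (a : R) u v :
  adj_op G (a *: u + v) = a *: adj_op G u + adj_op G v.
Proof.
apply/funext => x; change (adj_op G (a *: u + v) x = a * adj_op G u x + adj_op G v x).
rewrite !adj_opE mulr_sumr -big_split/=; apply: eq_bigr => y _.
change (wt G x y * (a * u y + v y) = a * (wt G x y * u y) + wt G x y * v y).
by lra.
Qed.

Lemma adj_op_off u x : ~ vset G x -> adj_op G u x = 0.
Proof.
move=> Gx; rewrite adj_opE big1_seq// => y /=; rewrite in_nbrs.
by move=> /(@adj_vset _ G)[].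
Qed.

Lemma dotl2_adj_op_unit u x : dotl2 u (adj_op G (unit_vec R x)) = adj_op G u x.
Proof.
have [M xM] := nbrs_bound x.
have AE z : adj_op G (unit_vec R x) z = wt G x z.
  have [M' zM'] := nbrs_bound z.
  rewrite (@adj_op_nat _ _ (maxn M' x.+1)); last first.
    by move=> y /zM' h; rewrite leq_max h.
  transitivity (series (fun y => wt G z y * unit_vec R x y) (maxn M' x.+1)) => //.
  rewrite (series_fin_supp (x := x)).
  - by rewrite /unit_vec eqxx mulr1 wt_sym.
  - by move=> y yx; rewrite /unit_vec eq_sym (negbTE yx) mulr0.
  - by rewrite leq_max ltnSn orbT.
rewrite (adj_op_nat _ xM) dotl2C.
rewrite -[RHS](@dotl2_truncatel _ M (wt G x) u).
congr (dotl2 _ _); apply/funext => z; rewrite AE /truncate.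
case: ltnP => // Mz; apply: wt_nadj; apply/negP => /xM.
by rewrite ltnNge Mz.
Qed.

Variables (D : nat) (W : R).
Hypothesis degD : forall x, vset G x -> (degree G x <= D)%N.
Hypothesis wtW : forall x y, adj G x y -> 0 < wt G x y <= W.
Hypothesis W_ge0 : 0 <= W.

Let K := D%:R * W.

Lemma K_ge0 : 0 <= K.
Proof. by rewrite mulr_ge0. Qed.

Lemma wt_ge0 x y : 0 <= wt G x y.
Proof.
have [/wtW/andP[/ltW//]|/(@wt_nadj _ G)->//] := boolP (adj G x y).
Qed.

Lemma row_sum_le x M : \sum_(0 <= y < M) wt G x y <= K.
Proof.
have [Gx|Gx] := pselect (vset G x); last first.
  rewrite big1 ?K_ge0// => y _; apply: wt_nadj; apply/negP.
  by move=> /(@adj_vset _ G)[].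
apply: (@le_trans _ _ (\sum_(0 <= y < M | adj G x y) W)).
  rewrite [leLHS](bigID (adj G x))/= [X in _ + X]big1 ?addr0.
    by apply: ler_sum => y /wtW/andP[].
  by move=> y /(@wt_nadj _ G).
rewrite -big_filter big_const_seq count_predT iter_addr_0 -mulr_natl ler_wpM2r//.
rewrite ler_nat; apply: leq_trans (degD Gx).
apply: uniq_leq_size; first by rewrite filter_uniq// iota_uniq.
by move=> y; rewrite mem_filter => /andP[xy _]; rewrite in_nbrs.
Qed.

(** Schur's test: Cauchy-Schwarz with weights [wt G x y] in each row, then an exchange of sums. By
    symmetry [K] bounds the column sums as well as the row sums. *)
Lemma adj_op_bound psi : sqsum psi -> sqsum (adj_op G psi) /\
  dotl2 (adj_op G psi) (adj_op G psi) <= K ^+ 2 * dotl2 psi psi.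
Proof.
move=> sp; apply: sqsum_bounded => N; have [M NM] := nbrs_bound_lt N.
apply: (@le_trans _ _ (\sum_(0 <= x < N) K * \sum_(0 <= y < M) wt G x y * psi y ^+ 2)).
  apply: ler_sum_nat => x /andP[_ xN]; rewrite (adj_op_nat _ (NM _ xN)).
  apply: le_trans (weighted_cauchy_schwarz _ _ _) _; first by move=> y; exact: wt_ge0.
  apply: ler_wpM2r; last exact: row_sum_le.
  by apply: sumr_ge0 => y _; rewrite mulr_ge0 ?sqr_ge0 ?wt_ge0.
rewrite -mulr_sumr expr2 -mulrA ler_wpM2l ?K_ge0// exchange_big/=.
apply: le_trans (ler_wpM2l K_ge0 (series_sqr_le_dotl2 M sp)).
rewrite mulr_sumr; apply: ler_sum => y _.
rewrite -mulr_suml ler_wpM2r ?sqr_ge0//.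
by under eq_bigr do rewrite wt_sym; exact: row_sum_le.
Qed.

Lemma l2_adj_op psi : l2 G psi -> l2 G (adj_op G psi).
Proof.
move=> [_ sp]; split; last exact: (adj_op_bound sp).1.
exact: adj_op_off.
Qed.

Lemma graph_bounded_adj_op : bounded_adj_op G.
Proof.
exists (K ^+ 2) => psi lp; split; first exact: l2_adj_op.
by apply: (adj_op_bound _).2; exact: l2_sqsum.
Qed.

Lemma dotl2_adj_op_truncate N u v : sqsum u -> sqsum v ->
  dotl2 u (adj_op G (truncate N v)) = series (fun x => adj_op G u x * v x) N.
Proof.
move=> su sv; elim: N => [|N IH].
  rewrite truncate0 /series/= big_geq// (_ : adj_op G 0 = 0).
    by have := dotl2Dr (-1) su su su; rewrite scaleN1r addNr mulN1r addNr.
  by rewrite -{1}(addr0 0) -{1}(scale0r 0) adj_op_linear scale0r add0r; apply/funext => x;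
    rewrite adj_opE big1// => y _; rewrite mulr0.
rewrite truncateS adj_op_linear dotl2Dr//.
- by rewrite IH dotl2_adj_op_unit seriesSr addrC mulrC.
- by have [] := adj_op_bound (@sqsum_unit R N).
- by have [] := adj_op_bound (sqsum_truncate (N := N) sv).
Qed.

(** For finitely supported v this is a finite computation. Both sides are limits of <u, A (truncate
    N v)>: the left one as a convergent series, the right one by boundedness of A. *)
Lemma adj_op_sym u v : sqsum u -> sqsum v ->
  dotl2 (adj_op G u) v = dotl2 u (adj_op G v).
Proof.
move=> su sv; have sAu := (adj_op_bound su).1; have sAv := (adj_op_bound sv).1.
have c1 : dotl2 u (adj_op G (truncate N v)) @[N --> \oo] --> dotl2 (adj_op G u) v.
  under eq_fun do rewrite dotl2_adj_op_truncate//.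
  exact: (sqsum_mul sAu sv).
have c2 : dotl2 u (adj_op G (truncate N v)) @[N --> \oo] -->
    dotl2 u (adj_op G v).
  apply/cvgrPdist_le => e e0; near=> N.
  have sN : sqsum (truncate N v) by exact: sqsum_truncate.
  have sd : sqsum (v - truncate N v) by rewrite addrC -scaleN1r; exact: sqsumD.
  have -> : dotl2 u (adj_op G v) - dotl2 u (adj_op G (truncate N v)) =
      dotl2 u (adj_op G (v - truncate N v)).
    rewrite (_ : v - truncate N v = (-1) *: truncate N v + v);
      last by rewrite scaleN1r addrC.
    rewrite adj_op_linear dotl2Dr//; first by lra.
    exact: (adj_op_bound sN).1.
  rewrite -(ler_pXn2r (n := 2))// ?nnegrE ?(ltW e0)// real_normK ?num_real//.
  apply: le_trans (dotl2_cauchy_schwarz su (adj_op_bound sd).1) _.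
  apply: le_trans (ler_wpM2l (dotl2_ge0 su) (adj_op_bound sd).2) _.
  rewrite mulrA; near: N.
  have c : (fun N => dotl2 u u * K ^+ 2 * dotl2 (v - truncate N v) (v - truncate N v))
      @ \oo --> dotl2 u u * K ^+ 2 * 0.
    by apply: cvgM; [exact: cvg_cst|exact: truncate_dist_cvg0].
  rewrite mulr0 in c.
  by apply: (cvgr_le _ c); rewrite exprn_gt0.
exact: cvg_unique c1 c2.
Unshelve. all: by end_near. Qed.

End GraphOperator.

(** * Walks, and the Perron-Frobenius theorem at the top of the spectrum *)

Section ShiftedOperator.
Context {R : realType}.
Variable G : wgraph R.
Implicit Types u v psi : nat -> R.

Definition shifted_op (c : R) psi : nat -> R := adj_op G psi + c *: psi.

Lemma shifted_opE c psi x : shifted_op c psi x = adj_op G psi x + c * psi x.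
Proof. by []. Qed.

(** The entry (B^n)(y,x): the total weight of the n-step walks between x and y once a loop of weight
    c is added at every vertex. *)
Definition walk_weight (c : R) n (x y : nat) : R :=
  iter n (shifted_op c) (unit_vec R x) y.

Lemma shifted_op_linear c (a : R) u v :
  shifted_op c (a *: u + v) = a *: shifted_op c u + shifted_op c v.
Proof.
rewrite /shifted_op adj_op_linear; apply/funext => x.
change (a * adj_op G u x + adj_op G v x + c * (a * u x + v x) =
  a * (adj_op G u x + c * u x) + (adj_op G v x + c * v x)).
by lra.
Qed.

Lemma shifted_opZ c (a : R) u : shifted_op c (a *: u) = a *: shifted_op c u.
Proof.
have := shifted_op_linear c 1 0 0; rewrite scaler0 addr0 => h.
rewrite -[a *: u]addr0 shifted_op_linear (_ : shifted_op c 0 = 0) ?addr0//.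
by apply: (addrI (shifted_op c 0)); rewrite addr0 [in RHS]h scale1r.
Qed.

Lemma connected_ind (P : nat -> Prop) o : vset G o -> P o ->
  (forall x y, adj G x y -> P x -> P y) -> forall v : nat, vset G v -> P v.
Proof.
move=> Go Po PS v Gv; have [p [pp <-]] := adj_connected Go Gv.
elim/last_ind: p pp => [//|p z IH]; rewrite rcons_path last_rcons => /andP[pp pz].
by apply: PS pz _; exact: IH.
Qed.

Lemma shifted_op_cvg c (u_ : nat -> nat -> R) u x :
  (forall z, u_ n z @[n --> \oo] --> u z) ->
  shifted_op c (u_ n) x @[n --> \oo] --> shifted_op c u x.
Proof.
move=> cu; rewrite shifted_opE adj_opE.
under eq_fun do rewrite shifted_opE adj_opE.
apply: cvgD; last by apply: cvgM => //; exact: cvg_cst.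
by apply: cvg_sum_seq => z _; apply: cvgM => //; exact: cvg_cst.
Qed.

Variables (D : nat) (W : R).
Hypothesis degD : forall x, vset G x -> (degree G x <= D)%N.
Hypothesis wtW : forall x y, adj G x y -> 0 < wt G x y <= W.
Hypothesis W_ge0 : 0 <= W.

Let K := D%:R * W.
Let B := shifted_op K.
Let K0 : 0 <= K := K_ge0 D W_ge0.
Let S := l2 G.
Let S_sub : subspace_set S := l2_subspace G.
Let S_sq : S `<=` sqsum := @l2_sqsum _ G.

Lemma shifted_op_symmetric : symmetric_op S B.
Proof.
have SA u : S u -> S (B u).
  by move=> Su; rewrite /B /shifted_op addrC; apply: S_sub.2 => //; exact: (l2_adj_op degD wtW).
split => //.
- by move=> a u v _ _; exact: shifted_op_linear.
- move=> u v Su Sv; have [su sv] := (S_sq Su, S_sq Sv).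
  have sA w : sqsum w -> sqsum (adj_op G w) by move=> /(adj_op_bound degD wtW W_ge0)[].
  rewrite /B /shifted_op ![adj_op _ _ + _]addrC dotl2Dl ?dotl2Dr//; try exact: sA.
  by rewrite (adj_op_sym degD wtW W_ge0).
Qed.

Let dotl2_adj_op_abs u : S u -> `|dotl2 u (adj_op G u)| <= K * dotl2 u u.
Proof.
move=> /S_sq su; have [sA leA] := adj_op_bound degD wtW W_ge0 su.
have u0 := dotl2_ge0 su.
rewrite -(ler_pXn2r (n := 2))// ?nnegrE ?mulr_ge0// real_normK ?num_real//.
apply: le_trans (dotl2_cauchy_schwarz su sA) _.
by apply: le_trans (ler_wpM2l u0 leA) _; rewrite -/K; lra.
Qed.

Let dotl2_BE u : S u -> dotl2 u (B u) = dotl2 u (adj_op G u) + K * dotl2 u u.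
Proof.
move=> /S_sq su; rewrite /B /shifted_op addrC dotl2Dr//; first by rewrite addrC.
by have [] := adj_op_bound degD wtW W_ge0 su.
Qed.

(** Schur's bound gives -K <= A <= K as quadratic forms, which is why the shift is by [K]. *)
Lemma shifted_op_ge0 u : S u -> 0 <= dotl2 u (B u).
Proof.
by move=> Su; rewrite dotl2_BE//; have := dotl2_adj_op_abs Su; rewrite ler_norml => /andP[]; lra.
Qed.

Lemma shifted_op_le2K u : S u -> dotl2 u (B u) <= (2 * K) * dotl2 u u.
Proof.
by move=> Su; rewrite dotl2_BE//; have := dotl2_adj_op_abs Su; rewrite ler_norml => /andP[]; lra.
Qed.

Lemma shifted_op_mono u v : (forall x, u x <= v x) -> forall x, B u x <= B v x.
Proof.
move=> uv x; rewrite /B !shifted_opE !adj_opE lerD ?ler_wpM2l//.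
by apply: ler_sum => y _; rewrite ler_wpM2l ?(wt_ge0 wtW).
Qed.

Lemma shifted_op0 : B 0 = 0.
Proof.
apply/funext => x; rewrite /B shifted_opE adj_opE big1 ?mulr0 ?addr0// => y _.
by rewrite mulr0.
Qed.

Lemma iter_shifted_op_ge0 n u : (forall x, 0 <= u x) -> forall x, 0 <= iter n B u x.
Proof.
move=> u0; elim: n => //= n IH x; apply: le_trans (shifted_op_mono IH x).
by change (0 <= B 0 x); rewrite shifted_op0.
Qed.

Lemma walk_weight_ge0 n x y : 0 <= walk_weight K n x y.
Proof. by apply: iter_shifted_op_ge0 => z; rewrite /unit_vec ler0n. Qed.

Lemma shifted_op_ge_nbr u x y : (forall z, 0 <= u z) -> adj G x y ->
  wt G x y * u y <= B u x.
Proof.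
move=> u0 xy; rewrite /B shifted_opE adj_opE -[leLHS]addr0 lerD ?mulr_ge0//.
rewrite (bigD1_seq y)/= ?in_nbrs//; last exact: fset_uniq.
by rewrite lerDl sumr_ge0// => z _; rewrite mulr_ge0 ?(wt_ge0 wtW).
Qed.

Lemma walk_weight_gt0 x y : vset G x -> vset G y ->
  exists k, 0 < walk_weight K k x y.
Proof.
move=> Gx; move: y; apply: (connected_ind Gx).
  by exists 0%N; rewrite /walk_weight /= /unit_vec eqxx.
move=> z y zy [k kz]; exists k.+1.
have yz : adj G y z by rewrite adj_sym.
apply: lt_le_trans (shifted_op_ge_nbr _ yz); last exact: walk_weight_ge0.
by rewrite mulr_gt0//; have /andP[] := wtW yz.
Qed.

Lemma dotl2_unit_iter n x y : dotl2 (unit_vec R y) (iter n B (unit_vec R x)) =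
  walk_weight K n x y.
Proof. exact: dotl2_unitl. Qed.

Lemma walk_weight_sym n x y : vset G x -> vset G y ->
  walk_weight K n x y = walk_weight K n y x.
Proof.
move=> Gx Gy; rewrite -!dotl2_unit_iter dotl2C (iter_sym shifted_op_symmetric)//; exact: l2_unit.
Qed.

Lemma dotl2_iter_unit n x : vset G x ->
  dotl2 (iter n B (unit_vec R x)) (iter n B (unit_vec R x)) =
  walk_weight K (n + n) x x.
Proof.
by move=> Gx; rewrite (dotl2_iterD shifted_op_symmetric) ?dotl2_unit_iter//; exact: l2_unit.
Qed.

(** * From a growth bound at one vertex to the rank one kernel at the top of the spectrum *)

Section TopOfSpectrum.
Variables (y : R) (o : nat).
Hypothesis y_gt0 : 0 < y.
Hypothesis o_vset : vset G o.
Hypothesis walk_le : forall n, walk_weight K (n + n) o o <= y ^+ (n + n).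

Let iterS n u : S u -> S (iter n B u).
Proof. by apply: iter_stable; exact: shifted_op_symmetric. Qed.

(** With a = (B^k)(o,v) > 0 one has a 1_v <= B^k 1_o entrywise, and B preserves this order. Hence |a
    B^n 1_v| <= |B^(n+k) 1_o| <= y^(n+k). *)
Let unit_growth (v : nat) : vset G v -> exists C, forall n,
  dotl2 (iter n B (unit_vec R v)) (iter n B (unit_vec R v)) <= C * (y ^+ n) ^+ 2.
Proof.
move=> Gv; have [k ka] := walk_weight_gt0 o_vset Gv.
set a := walk_weight K k o v in ka.
have ptw n x : a * iter n B (unit_vec R v) x <= iter (n + k) B (unit_vec R o) x.
  rewrite iterD.
  elim: n x => [z|m IH z].
    change (a * (v == z)%:R <= walk_weight K k o z).
    by case: eqVneq => [<-|_]; rewrite ?mulr1// mulr0 walk_weight_ge0.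
  apply: le_trans (shifted_op_mono IH z).
  change (a * B (iter m B (unit_vec R v)) z <= B (a *: iter m B (unit_vec R v)) z).
  by rewrite /B shifted_opZ.
exists ((y ^+ k) ^+ 2 / a ^+ 2) => n.
rewrite -mulrA mulrC -mulrA ler_pdivlMl ?exprn_gt0//.
set f := iter n B _.
have sf : sqsum f by apply/S_sq/iterS/l2_unit.
have -> : a ^+ 2 * dotl2 f f = dotl2 (a *: f) (a *: f).
  by rewrite dotl2Zl ?dotl2Zr ?mulrA//; exact: sqsumZ.
set h := iter (n + k) B (unit_vec R o).
have sh : sqsum h by apply/S_sq/iterS/l2_unit.
apply: (@le_trans _ _ (dotl2 h h)).
  apply: (@sqsum_le _ _ h _ sh).2 => x.
  change (`|a * f x| <= `|h x|).
  have f0 : 0 <= f x by apply: walk_weight_ge0.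
  have h0 : 0 <= h x by apply: walk_weight_ge0.
  by rewrite !ger0_norm ?mulr_ge0 ?(ltW ka)//; exact: ptw.
rewrite dotl2_iter_unit//; apply: le_trans (walk_le _) _.
by rewrite !exprD -!expr2 mulrC; lra.
Qed.

Let fin_growth N u : S u -> exists C, forall n,
  dotl2 (iter n B (truncate N u)) (iter n B (truncate N u)) <= C * (y ^+ n) ^+ 2.
Proof.
move=> Su; elim: N => [|N [C IH]].
  exists 0 => n; rewrite truncate0 mul0r (_ : iter n B 0 = 0); last first.
    by elim: n => //= n ->; exact: shifted_op0.
  by rewrite dotl20.
have [Gv|Gv] := pselect (vset G N); last first.
  by exists C => n; rewrite truncateS Su.1// scale0r add0r.
have [C' uC] := unit_growth Gv.
have St : S (truncate N u) by exact: l2_truncate.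
have SN : S (unit_vec R N) by exact: l2_unit.
exists (2 * (u N) ^+ 2 * C' + 2 * C) => n.
rewrite truncateS (iter_linear shifted_op_symmetric)//.
apply: le_trans (dotl2_add_le _ _ _) _; try by apply/S_sq/iterS.
have u2 : 0 <= 2 * u N ^+ 2 by rewrite mulr_ge0 ?sqr_ge0.
by have := ler_wpM2l u2 (uC n); have := IH n; lra.
Qed.

(** For truncations of u, [growth_bound] absorbs the constant of [fin_growth], whatever its
    dependence on N. Fatou then handles u itself, B being continuous for pointwise limits. *)
Lemma shifted_op_bound u : S u -> dotl2 (B u) (B u) <= y ^+ 2 * dotl2 u u.
Proof.
move=> Su; have St N : S (truncate N u) by exact: l2_truncate.
apply: (@sqsum_fatou _ (fun N => B (truncate N u)) _ (fun=> y ^+ 2 * dotl2 u u) _ _ _ _ _).2.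
- by move=> x; apply: shifted_op_cvg => z; exact: truncate_cvg.
- by move=> n; apply/S_sq/(symop_stable shifted_op_symmetric).
- move=> N; have [C h] := fin_growth N Su.
  apply: le_trans (growth_bound S_sq shifted_op_symmetric y_gt0 (St N) h) _.
  rewrite ler_wpM2l ?sqr_ge0//; apply: (@sqsum_le _ _ u _ (S_sq Su)).2 => x.
  by rewrite /truncate; case: ifP => //; rewrite normr0.
- exact: cvg_cst.
Qed.

Lemma shifted_op_le u : S u -> dotl2 u (B u) <= y * dotl2 u u.
Proof.
move=> Su; have su := S_sq Su; have u0 := dotl2_ge0 su.
rewrite -(ler_pXn2r (n := 2))// ?nnegrE ?shifted_op_ge0// ?mulr_ge0 ?(ltW y_gt0)//.
apply: le_trans (dotl2_cauchy_schwarz su _) _.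
  exact/S_sq/(symop_stable shifted_op_symmetric).
by apply: le_trans (ler_wpM2l u0 (shifted_op_bound Su)) _; lra.
Qed.

(** As 0 <= B <= y, the powers (B/y)^n tend to the orthogonal projection onto the eigenspace of B at
    y; this is its matrix. *)
Definition top_kernel (x z : nat) : R :=
  limn (fun n => walk_weight K n x z / y ^+ n).

Lemma walk_weight_off n x z : vset G x -> ~ vset G z -> walk_weight K n x z = 0.
Proof.
by move=> Gx Gz; have [h _] : S (iter n B (unit_vec R x)); [exact/iterS/l2_unit|exact: h].
Qed.

Lemma top_kernel_cvg x z : vset G x ->
  walk_weight K n x z / y ^+ n @[n --> \oo] --> top_kernel x z.
Proof.
move=> Gx; have [Gz|Gz] := pselect (vset G z); last first.
  apply/cvg_ex; exists 0; under eq_fun do rewrite walk_weight_off// mul0r.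
  exact: cvg_cst.
rewrite /top_kernel; under eq_fun do rewrite -dotl2_unit_iter.
by apply: (moment_cvg S_sub S_sq shifted_op_symmetric (ltW y_gt0) shifted_op_ge0 shifted_op_le) => //;
  exact: l2_unit.
Qed.

Lemma top_kernel_ge0 x z : vset G x -> 0 <= top_kernel x z.
Proof.
move=> Gx; apply: (cvgr_to_ge (top_kernel_cvg (z := z) Gx)); apply: nearW => n.
by rewrite divr_ge0 ?walk_weight_ge0// exprn_ge0// ltW.
Qed.

Lemma top_kernel_sym x z : vset G x -> vset G z -> top_kernel x z = top_kernel z x.
Proof.
by move=> Gx Gz; rewrite /top_kernel; under eq_fun do rewrite walk_weight_sym//.
Qed.

(** The vectors B^n 1_x / y^n converge pointwise to the row of x, and their squared norms,
    (B^(2n))(x,x) / y^(2n), converge to the diagonal entry; Fatou concludes. *)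
Lemma top_kernel_l2 x : vset G x -> S (top_kernel x) /\
  dotl2 (top_kernel x) (top_kernel x) <= top_kernel x x.
Proof.
move=> Gx; pose f n := (y ^+ n)^-1 *: iter n B (unit_vec R x).
have Sf n : S (f n) by apply: subspace_scale => //; exact/iterS/l2_unit.
have sit n : sqsum (iter n B (unit_vec R x)) by exact/S_sq/iterS/l2_unit.
have [||n||sq le] := @sqsum_fatou _ f (top_kernel x)
    (fun n => walk_weight K (n + n) x x / y ^+ (n + n)) (top_kernel x x).
- move=> z; have := top_kernel_cvg (z := z) Gx.
  rewrite (_ : (fun n => _ / _) = fun n => f n z)//; apply/funext => n.
  by change (walk_weight K n x z / y ^+ n = (y ^+ n)^-1 * walk_weight K n x z);
    rewrite mulrC.
- by move=> n; exact: S_sq.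
- rewrite -dotl2_iter_unit// /f dotl2Zl ?dotl2Zr//; last exact: sqsumZ.
  by rewrite exprD invfM mulrA mulrC.
- have dbl : (n + n)%N @[n --> \oo] --> \oo.
    by move=> A [N _ NA]; exists N => // n /= Nn; apply: NA; exact: leq_trans (leq_addr _ _).
  exact: (cvg_comp _ _ dbl (top_kernel_cvg (z := x) Gx)).
split => //; split => // z Gz.
by rewrite /top_kernel; under eq_fun do rewrite walk_weight_off// mul0r; exact: lim_cst.
Qed.

Lemma top_kernel_eigen x z : vset G x -> B (top_kernel x) z = y * top_kernel x z.
Proof.
move=> Gx; have c1 := shifted_op_cvg (c := K) (x := z) (fun t => top_kernel_cvg (z := t) Gx).
apply: (cvg_unique _ c1) => //.
have -> : (fun n => shifted_op K (fun t => walk_weight K n x t / y ^+ n) z) =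
  fun n => y * (walk_weight K n.+1 x z / y ^+ n.+1).
  apply/funext => n.
  have -> : (fun t => walk_weight K n x t / y ^+ n) =
      (y ^+ n)^-1 *: iter n B (unit_vec R x).
    by apply/funext => t;
      change (walk_weight K n x t / y ^+ n = (y ^+ n)^-1 * walk_weight K n x t);
      rewrite mulrC.
  rewrite shifted_opZ.
  change ((y ^+ n)^-1 * walk_weight K n.+1 x z = y * (walk_weight K n.+1 x z / y ^+ n.+1)).
  by rewrite mulrCA exprS invfM mulVKf ?gt_eqF// mulrC.
apply: cvgM; first exact: cvg_cst.
by rewrite (cvg_shiftS (fun n => walk_weight K n x z / y ^+ n)); exact: top_kernel_cvg.
Qed.

(** Zeros spread along edges: for s adjacent to t, wt(s,t) u(t) <= (B u)(s) = y u(s), so u(s) = 0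
    forces u(t) = 0. Contrapositively, one positive value makes u positive everywhere. *)
Lemma eigen_gt0 u x z : (forall t, 0 <= u t) ->
  (forall t, vset G t -> B u t = y * u t) -> vset G x -> vset G z ->
  u x = 0 -> u z = 0.
Proof.
move=> u0 uy Gx + ux; move: z; apply: (connected_ind Gx) => // s t st us.
have [Gs _] := adj_vset st; have /andP[w0 _] := wtW st.
have := shifted_op_ge_nbr u0 st; rewrite uy// us mulr0 pmulr_rle0// => h.
by apply/eqP; rewrite eq_le h u0.
Qed.

(** The entries of B are nonnegative, so replacing u by its absolute value preserves the norm and
    can only raise <u, B u>, already equal to its maximum y |u|^2. *)
Lemma top_eigen_abs u t : S u -> (forall z, B u z = y * u z) -> vset G t ->
  B (fun z => `|u z|) t = y * `|u t|.
Proof.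
move=> Su uy Gt; have Sa := l2_abs Su.
suff h : y * dotl2 (fun z => `|u z|) (fun z => `|u z|) <=
    dotl2 (fun z => `|u z|) (B (fun z => `|u z|)).
  have := top_eigenvector S_sub S_sq shifted_op_symmetric shifted_op_le
    Sa (l2_unit Gt) h.
  by rewrite !dotl2_unitr.
rewrite dotl2_abs; have -> : y * dotl2 u u = dotl2 u (B u).
  have -> : B u = y *: u by apply/funext => z; rewrite uy.
  by rewrite dotl2Zr//; exact: S_sq.
apply: ler_dotl2; try exact: S_sq; try exact/S_sq/(symop_stable shifted_op_symmetric).
move=> z; rewrite /B !shifted_opE !adj_opE !mulrDr lerD//; last first.
  by rewrite !(mulrCA _ K) ler_wpM2l// -normrM ler_norm.
rewrite !mulr_sumr; apply: ler_sum => s _.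
rewrite !(mulrCA _ (wt _ _ _)) ler_wpM2l ?(wt_ge0 wtW)//.
by rewrite -normrM ler_norm.
Qed.

(** The combination u of the rows of x and z is chosen to vanish at x. Its absolute value is a
    nonnegative eigenvector with a zero, so u vanishes at z too, which is the claimed identity. *)
Lemma top_kernel_rank1 x z : vset G x -> vset G z ->
  top_kernel x x * top_kernel z z = top_kernel x z ^+ 2.
Proof.
move=> Gx Gz.
pose u := top_kernel x x *: top_kernel z + (- top_kernel z x) *: top_kernel x.
have Su : S u.
  apply: S_sub.2; first exact: (top_kernel_l2 Gz).1.
  by apply: subspace_scale => //; exact: (top_kernel_l2 Gx).1.
have uE t : u t = top_kernel x x * top_kernel z t +
   (- top_kernel z x * top_kernel x t) by [].
have uy t : B u t = y * u t.
  rewrite /u /B shifted_op_linear shifted_opZ -/B.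
  change (top_kernel x x * B (top_kernel z) t +
   (- top_kernel z x * B (top_kernel x) t) = y * u t).
  by rewrite !top_kernel_eigen// uE; lra.
have : `|u z| = 0.
  apply: (@eigen_gt0 (fun t => `|u t|) x) => //.
  - by move=> t Gt; exact: top_eigen_abs.
  - by apply/eqP; rewrite normr_eq0 uE; apply/eqP; lra.
by move/eqP; rewrite normr_eq0 uE [top_kernel z x]top_kernel_sym// => /eqP; lra.
Qed.

(** If L(z,z) = 0, the row of z has a zero at z, hence at x; by symmetry the row of x has a zero at
    z, hence at x. *)
Lemma top_kernel_gt0 x z : vset G x -> vset G z -> top_kernel x x != 0 ->
  top_kernel z z != 0.
Proof.
move=> Gx Gz; apply: contraNN => /eqP zz.
have : top_kernel z x = 0.
  apply: (@eigen_gt0 (top_kernel z) z) => //.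
  - by move=> t; exact: top_kernel_ge0.
  - by move=> t _; exact: top_kernel_eigen.
move=> zx; apply/eqP; apply: (@eigen_gt0 (top_kernel x) z) => //.
- by move=> t; exact: top_kernel_ge0.
- by move=> t _; exact: top_kernel_eigen.
- by rewrite top_kernel_sym.
Qed.

(** By rank one, L(x,x) times the sum of the L(z,z) is the sum of the L(x,z)^2, at most L(x,x) by
    [top_kernel_l2]. If L(x,x) = 0, every diagonal entry vanishes. *)
Lemma top_kernel_sum_le1 x (X : seq nat) : vset G x -> uniq X ->
  {in X, forall z, vset G z} -> \sum_(z <- X) top_kernel z z <= 1.
Proof.
move=> Gx uX XG; have [x0|x0] := eqVneq (top_kernel x x) 0.
  rewrite big1_seq//= => z /XG Gz; apply/eqP.
  by apply: contraTT (eqxx (0 : R)) => /(top_kernel_gt0 Gz Gx); rewrite x0 eqxx.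
have xpos : 0 < top_kernel x x by rewrite lt_neqAle eq_sym x0 top_kernel_ge0.
rewrite -(ler_pM2l xpos) mulr1 mulr_sumr.
rewrite (eq_big_seq (fun z => top_kernel x z ^+ 2)); last first.
  by move=> z /XG Gz; exact: top_kernel_rank1.
have [sl le] := top_kernel_l2 Gx.
by apply: le_trans le; apply: sum_sqr_le_dotl2 => //; exact: S_sq.
Qed.

End TopOfSpectrum.

End ShiftedOperator.

(** * Spectral subspaces *)

Section SpectralSubspaces.
Context {R : realType}.
Variables (G : wgraph R) (P : set R -> (nat -> R) -> (nat -> R)).
Hypothesis P_spec : is_spectral_measure G P.
Let A := adj_op G.
Hypothesis A_sym : symmetric_op (l2 G) A.
Implicit Types (E F : set R) (u v psi : nat -> R).

Definition spectral_range E : set (nat -> R) := [set u | l2 G u /\ P E u = u].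

Definition spectral_kernel E : set (nat -> R) := [set u | l2 G u /\ P E u = 0].

Let S_sq : l2 G `<=` sqsum := @l2_sqsum _ G.

Lemma spectral_proj0 E : measurable E -> P E 0 = 0.
Proof.
move=> mE; have l0 : l2 G (0 : nat -> R) by exact: (l2_subspace G).1.
have := spec_linear P_spec 1 mE l0 l0; rewrite scaler0 addr0 scale1r => h.
by apply: (addrI (P E 0)); rewrite addr0 [in RHS]h.
Qed.

Lemma spectral_rangeP E u : measurable E -> l2 G u -> spectral_range E (P E u).
Proof. by move=> mE lu; split; [exact: (spec_l2 P_spec)|exact: (spec_idem P_spec)]. Qed.

Lemma spectral_range_subspace E : measurable E -> subspace_set (spectral_range E).
Proof.
move=> mE; have [l0 lD] := l2_subspace G.
split=> [|a u v [lu Pu] [lv Pv]].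
  by split => //; exact: spectral_proj0.
by split; [exact: lD|rewrite (spec_linear P_spec)// Pu Pv].
Qed.

Lemma spectral_kernel_subspace E : measurable E -> subspace_set (spectral_kernel E).
Proof.
move=> mE; have [l0 lD] := l2_subspace G.
split=> [|a u v [lu Pu] [lv Pv]].
  by split => //; exact: spectral_proj0.
by split; [exact: lD|rewrite (spec_linear P_spec)// Pu Pv scaler0 addr0].
Qed.

Lemma spectral_kernelB E u : measurable E -> l2 G u ->
  spectral_kernel E ((-1) *: P E u + u).
Proof.
move=> mE lu; have lP := spec_l2 P_spec mE lu.
split; first exact: (l2_subspace G).2.
by rewrite (spec_linear P_spec)// (spec_idem P_spec)// scaleN1r addNr.
Qed.

Lemma dotl2_range_kernel E u v : measurable E -> spectral_range E u ->
  spectral_kernel E v -> dotl2 u v = 0.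
Proof.
move=> mE [lu <-] [lv Pv].
by rewrite -(spec_sym P_spec)// Pv dotl2C dotl20.
Qed.

Definition spectral_mass u E : R := dotl2 u (P E u).

Lemma spectral_massE u E : measurable E -> l2 G u ->
  spectral_mass u E = dotl2 (P E u) (P E u).
Proof.
move=> mE lu; rewrite /spectral_mass -[in LHS](spec_idem P_spec)//.
by rewrite (spec_sym P_spec)//; exact: (spec_l2 P_spec).
Qed.

Lemma spectral_mass_ge0 u E : measurable E -> l2 G u -> 0 <= spectral_mass u E.
Proof. by move=> mE lu; rewrite spectral_massE//; apply/dotl2_ge0/S_sq/(spec_l2 P_spec). Qed.

Lemma spectral_mass_eq0 u E : measurable E -> l2 G u ->
  spectral_mass u E = 0 -> P E u = 0.
Proof.
move=> mE lu; rewrite spectral_massE// => /dotl2_eq0; apply.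
by apply/S_sq/(spec_l2 P_spec).
Qed.

Lemma spectral_massT u : l2 G u -> spectral_mass u setT = dotl2 u u.
Proof. by move=> lu; rewrite /spectral_mass (spec_setT P_spec). Qed.

Lemma spectral_mass_setU u E F : measurable E -> measurable F -> [disjoint E & F] ->
  l2 G u -> spectral_mass u (E `|` F) = spectral_mass u E + spectral_mass u F.
Proof.
move=> mE mF EF lu; have [m [mP _ _]] := spec_integral P_spec lu.
apply: EFin_inj; rewrite EFinD -!mP//; last exact: measurableU.
by rewrite measureU//; apply/eqP; rewrite -disj_set2E.
Qed.

Lemma spectral_kernel_subset u E F : measurable E -> measurable F -> F `<=` E ->
  spectral_kernel E u -> P F u = 0.
Proof.
move=> mE mF FE [lu Eu]; apply: spectral_mass_eq0 => //.
apply/eqP; rewrite eq_le spectral_mass_ge0// andbT.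
have : spectral_mass u E = 0 by rewrite spectral_massE// Eu dotl20.
move=> <-; have [m [mP _ _]] := spec_integral P_spec lu.
by rewrite -lee_fin -!mP// le_measure ?inE.
Qed.

Lemma spectral_mass_setC u E : measurable E -> l2 G u ->
  spectral_mass u E + spectral_mass u (~` E) = dotl2 u u.
Proof.
move=> mE lu; rewrite -spectral_mass_setU//; last 2 first.
- exact: measurableC.
- by apply/disj_setPS; rewrite setICr.
by rewrite setUv spectral_massT.
Qed.

Lemma spectral_range_kernelC u E : measurable E -> spectral_range E u ->
  spectral_kernel (~` E) u.
Proof.
move=> mE [lu Eu]; split=> //; apply: spectral_mass_eq0 => //; first exact: measurableC.
by have := spectral_mass_setC mE lu; rewrite /spectral_mass Eu; lra.
Qed.

(** Split F along E: v contributes nothing on the part inside E, and u nothing on the part outside,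
    so no cross term appears. *)
Lemma spectral_mass_range_kernel u v E F : measurable E -> measurable F ->
  spectral_range E u -> spectral_kernel E v ->
  spectral_mass (1 *: u + v) F = spectral_mass u F + spectral_mass v F.
Proof.
move=> mE mF Eu Ev; have [lu _] := Eu; have [lv _] := Ev.
have mFE : measurable (F `&` E) by exact: measurableI.
have mFC : measurable (F `&` ~` E) by apply: measurableI => //; exact: measurableC.
have split_mass w : l2 G w -> spectral_mass w F =
    spectral_mass w (F `&` E) + spectral_mass w (F `&` ~` E).
  move=> lw; rewrite -spectral_mass_setU//.
    by rewrite -setIUr setUv setIT.
  by apply/disj_setPS => t [[_ Et] [_ /(_ Et)]].
have luv : l2 G (1 *: u + v) by exact: (l2_subspace G).2.
rewrite !split_mass// !spectral_massE// !(spec_linear P_spec)//.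
rewrite (spectral_kernel_subset mE mFE _ Ev); last exact: subIsetr.
have mCE := measurableC mE.
rewrite (spectral_kernel_subset mCE mFC _ (spectral_range_kernelC mE Eu));
  last exact: subIsetr.
by rewrite scaler0 add0r !addr0 scale1r !dotl20 addr0 add0r.
Qed.

(* The spectral measure of u + v is the sum of those of u and v, hence so is
   its first moment, the quadratic form of A. *)
Lemma dotl2_range_op_kernel u v E : measurable E ->
  spectral_range E u -> spectral_kernel E v -> dotl2 u (A v) = 0.
Proof.
move=> mE Eu Ev; have [lu _] := Eu; have [lv _] := Ev.
have luv : l2 G (1 *: u + v) by exact: (l2_subspace G).2.
have [mu [muP muI muA]] := spec_integral P_spec lu.
have [mv [mvP mvI mvA]] := spec_integral P_spec lv.
have [m [mP mI mA]] := spec_integral P_spec luv.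
have : (\int[m]_t t%:E = \int[measure_add mu mv]_t t%:E)%E.
  apply: eq_measure_integral => F mF _.
  rewrite mP// [RHS]measure_addE muP// mvP// -EFinD; congr EFin.
  exact: spectral_mass_range_kernel mE mF Eu Ev.
rewrite integral_measure_add//.
rewrite -mA -muA -mvA -EFinD => h.
have {h} := EFin_inj h.
have [lAu lAv] := (symop_stable A_sym lu, symop_stable A_sym lv).
have [[su sv] [sAu sAv]] := ((S_sq lu, S_sq lv), (S_sq lAu, S_sq lAv)).
rewrite adj_op_linear dotl2Dl ?dotl2Dr//; last exact: sqsumD.
by rewrite [dotl2 v (adj_op G u)]dotl2C (symop_sym A_sym)//; rewrite /A; lra.
Qed.

(** Stability of the kernel and of the range together say that [P E] commutes with A. Here the mass
    of A u on E pairs the range vector P E (A u) with A u, where u is in the kernel. *)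
Lemma spectral_kernel_stable u E : measurable E -> spectral_kernel E u ->
  spectral_kernel E (A u).
Proof.
move=> mE Eu; have [lu _] := Eu; have lA := symop_stable A_sym lu.
split => //; apply: spectral_mass_eq0 => //.
rewrite /spectral_mass dotl2C.
exact: dotl2_range_op_kernel mE (spectral_rangeP mE lA) Eu.
Qed.

(** The kernel component v of A u satisfies |v|^2 = <v, A u> = <A v, u> = 0. *)
Lemma spectral_range_stable u E : measurable E -> spectral_range E u ->
  spectral_range E (A u).
Proof.
move=> mE Eu; have [lu _] := Eu; have lA := symop_stable A_sym lu.
split => //; pose v := (-1) *: P E (A u) + A u.
have kv : spectral_kernel E v := spectral_kernelB mE lA.
have [lv _] := kv; have sv := S_sq lv.
have lP := spec_l2 P_spec mE lA.
suff /(dotl2_eq0 sv) /eqP : dotl2 v v = 0.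
  by rewrite /v scaleN1r addrC subr_eq0 => /eqP <-.
rewrite {2}/v dotl2Dr//; [|exact: S_sq|exact: S_sq].
rewrite [dotl2 v (P _ _)]dotl2C (dotl2_range_kernel mE (spectral_rangeP mE lA) kv).
rewrite mulr0 add0r -(symop_sym A_sym)// dotl2C.
exact: dotl2_range_op_kernel mE Eu kv.
Qed.

Lemma spectral_symmetric_op (S : set (nat -> R)) : S `<=` l2 G ->
  (forall u, S u -> S (A u)) -> symmetric_op S A.
Proof.
move=> Sl SA; split => // [a u v _ _|u v Su Sv]; first exact: adj_op_linear.
by apply: (symop_sym A_sym); exact: Sl.
Qed.

Lemma dotl2_op_le_above u (x : R) : l2 G u -> P `]x, +oo[%classic u = 0 ->
  dotl2 u (A u) <= x * dotl2 u u.
Proof.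
move=> lu u0; have [m [mP mI mA]] := spec_integral P_spec lu.
have mN : measurable (`]x, +oo[%classic : set R) by exact: measurable_itv.
have mN0 : m `]x, +oo[%classic = 0%E.
  by rewrite mP// u0 dotl2C dotl20.
have mT : m setT = (dotl2 u u)%:E by rewrite mP// (spec_setT P_spec).
have intx : m.-integrable setT (cst x%:E).
  apply/integrableP; split; first exact: measurable_cst.
  by rewrite integral_cst// mT ltry.
rewrite -lee_fin mA EFinM -mT -integral_cst//.
rewrite (negligible_integral mN _ mI)// (negligible_integral mN _ intx)//.
have mD : measurable (setT `\` `]x, +oo[%classic : set R) by exact: measurableD.
apply: le_integral => //.
- exact: integrableS mI.
- exact: integrableS intx.
- move=> t; rewrite inE /= => -[_]; rewrite in_itv/= andbT => /negP.
  by rewrite -leNgt lee_fin.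
Qed.

Lemma dotl2_op_point u (x : R) : spectral_range [set x] u ->
  dotl2 u (A u) = x * dotl2 u u.
Proof.
move=> xu; have [lu Pu] := xu; have [m [mP mI mA]] := spec_integral P_spec lu.
have mx : measurable [set x] by exact: measurable_set1.
have mN := measurableC mx.
have mN0 : m (~` [set x]) = 0%E.
  by rewrite mP// (spectral_range_kernelC mx xu).2 dotl2C dotl20.
have mT : m [set x] = (dotl2 u u)%:E by rewrite mP// Pu.
apply: EFin_inj; rewrite mA EFinM -mT -integral_cst//.
rewrite (negligible_integral mN _ mI)// setTD setCK.
by apply: eq_integral => t; rewrite inE => ->.
Qed.

(** On this range <w, A w> = x |w|^2, so every vector is a maximizer and [top_eigenvector] applies.
    Testing it on v = A u - x u, which stays in the range, gives |v|^2 = 0. *)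
Lemma spectral_range_point u (x : R) : spectral_range [set x] u -> A u = x *: u.
Proof.
move=> xu; have mx : measurable [set x] by exact: measurable_set1.
have sub := spectral_range_subspace mx.
have Rl : spectral_range [set x] `<=` l2 G by move=> v [].
have Rsq : spectral_range [set x] `<=` sqsum by move=> v /Rl /S_sq.
have As := spectral_symmetric_op Rl (fun u => spectral_range_stable (u := u) mx).
pose v := (- x) *: u + A u.
have Av : spectral_range [set x] v by apply: sub.2 => //; exact: spectral_range_stable.
have h : dotl2 (A u) v = x * dotl2 u v.
  apply: (top_eigenvector sub Rsq As) => // [w xw|]; first by rewrite (dotl2_op_point xw).
  by rewrite (dotl2_op_point xu).
have : dotl2 v v = 0.
  rewrite {1}/v dotl2Dl ?h; [lra|exact: Rsq|exact/Rsq/spectral_range_stable|exact: Rsq].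
move=> /(dotl2_eq0 (Rsq _ Av)) /eqP; rewrite /v scaleNr addrC subr_eq0.
by move/eqP.
Qed.

End SpectralSubspaces.

(** * Spectral masses at the root against walk weights *)

Section SpectralWalks.
Context {R : realType}.
Variables (G : wgraph R) (P : set R -> (nat -> R) -> (nat -> R)).
Hypothesis P_spec : is_spectral_measure G P.
Variables (D : nat) (W : R).
Hypothesis degD : forall x, vset G x -> (degree G x <= D)%N.
Hypothesis wtW : forall x y, adj G x y -> 0 < wt G x y <= W.
Hypothesis W_ge0 : 0 <= W.
Let K := D%:R * W.
Let B := shifted_op G K.
Let S_sub : subspace_set (l2 G) := l2_subspace G.
Let S_sq : l2 G `<=` sqsum := @l2_sqsum _ G.
Let K0 : 0 <= K := K_ge0 D W_ge0.
Let B_sym : symmetric_op (l2 G) B := shifted_op_symmetric degD wtW W_ge0.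

Lemma adj_op_symmetric : symmetric_op (l2 G) (adj_op G).
Proof.
split => [u lu|a u v _ _|u v lu lv].
- exact: (l2_adj_op degD wtW).
- exact: adj_op_linear.
- by apply: (adj_op_sym degD wtW W_ge0); exact: S_sq.
Qed.

Variable o : nat.
Hypothesis Go : vset G o.

(** Decompose 1_o = u + v along the range and kernel of P(]x,oo[). B preserves both, so |B^n 1_o|^2
    = |B^n u|^2 + |B^n v|^2, with B <= 2K on the first part and B <= x + K on the second. The mass
    is kept as an error term because only its integral over the random graph is known to vanish. *)
Lemma walk_weight_le_mass (x : R) n : 0 <= x ->
  walk_weight G K (n + n) o o <=
  ((2 * K) ^+ n) ^+ 2 * spectral_mass P (unit_vec R o) `]x, +oo[%classic +
  ((x + K) ^+ n) ^+ 2.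
Proof.
move=> x0; set E := `]x, +oo[%classic.
have mE : measurable E by exact: measurable_itv.
have lo := l2_unit Go; pose u := P E (unit_vec R o).
pose v := (-1) *: u + unit_vec R o.
have Ru : spectral_range G P E u := spectral_rangeP P_spec mE lo.
have Kv : spectral_kernel G P E v := spectral_kernelB P_spec mE lo.
have [lu lv] := (Ru.1, Kv.1).
have kl : spectral_kernel G P E `<=` l2 G by move=> w [].
have ksq : spectral_kernel G P E `<=` sqsum by move=> w /kl /S_sq.
have ksub := spectral_kernel_subspace P_spec mE.
have rsub := spectral_range_subspace P_spec mE.
have kB w : spectral_kernel G P E w -> spectral_kernel G P E (B w).
  move=> kw; rewrite /B /shifted_op addrC; apply: ksub.2 => //.
  exact: (spectral_kernel_stable P_spec adj_op_symmetric).
have rB w : spectral_range G P E w -> spectral_range G P E (B w).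
  move=> rw; rewrite /B /shifted_op addrC; apply: rsub.2 => //.
  exact: (spectral_range_stable P_spec adj_op_symmetric).
have kB_sym : symmetric_op (spectral_kernel G P E) B.
  split => // [a w z _ _|w z kw kz]; first exact: shifted_op_linear.
  by apply: (symop_sym B_sym); exact: kl.
have un_range : spectral_range G P E (iter n B u).
  by elim: (n) => //= m; exact: rB.
have vn_kernel : spectral_kernel G P E (iter n B v).
  by elim: (n) => //= m; exact: kB.
have [sun svn] := (S_sq un_range.1, S_sq vn_kernel.1).
have oE : unit_vec R o = 1 *: u + v by rewrite /v scale1r scaleN1r addNKr.
clearbody v.
have vK w : spectral_kernel G P E w -> dotl2 w (B w) <= (x + K) * dotl2 w w.
  move=> [lw Ew]; have sAw := S_sq (symop_stable adj_op_symmetric lw).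
  rewrite /B /shifted_op addrC dotl2Dr//; [|exact: S_sq|exact: S_sq].
  by have := dotl2_op_le_above P_spec lw Ew; lra.
have vn_le : dotl2 (iter n B v) (iter n B v) <= ((x + K) ^+ n) ^+ 2.
  apply: le_trans (dotl2_iter_le ksub ksq kB_sym _ _ vK _ Kv) _.
  - by rewrite addr_ge0.
  - by move=> w /kl; exact: (shifted_op_ge0 degD wtW W_ge0).
  rewrite -[leRHS]mulr1 ler_wpM2l ?sqr_ge0//.
  have : dotl2 (unit_vec R o) (unit_vec R o) = 1 by rewrite dotl2_unitl /unit_vec eqxx.
  have uv := dotl2_range_kernel P_spec mE Ru Kv.
  have [su sv] := (S_sq lu, S_sq lv).
  rewrite {1 2}oE dotl2Dl ?dotl2Dr//; last by rewrite -oE; exact: sqsum_unit.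
  by rewrite [dotl2 v u]dotl2C uv; have := dotl2_ge0 su; lra.
have un_le : dotl2 (iter n B u) (iter n B u) <=
    ((2 * K) ^+ n) ^+ 2 * spectral_mass P (unit_vec R o) E.
  rewrite (spectral_massE P_spec)//.
  apply: (dotl2_iter_le S_sub S_sq B_sym) => //.
  - by rewrite mulr_ge0.
  - by move=> w; exact: (shifted_op_ge0 degD wtW W_ge0).
  - by move=> w; exact: (shifted_op_le2K degD wtW W_ge0).
rewrite -(dotl2_iter_unit degD wtW W_ge0 _ Go) oE (iter_linear B_sym)//.
have sn : sqsum (1 *: iter n B u + iter n B v) by exact: sqsumD.
rewrite dotl2Dl// !dotl2Dr// [dotl2 (iter n B v) (iter n B u)]dotl2C.
rewrite (dotl2_range_kernel P_spec mE un_range vn_kernel).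
by rewrite -oE; lra.
Qed.

(** The vector u = P({x}) 1_o satisfies B u = (x + K) u and u(o) = |u|^2. Cauchy-Schwarz between B^n
    1_o and u, whose product is (x + K)^n |u|^2, gives the bound. *)
Lemma spectral_mass_point_le (x : R) n : 0 < x + K ->
  spectral_mass P (unit_vec R o) [set x] <=
  walk_weight G K (n + n) o o / (x + K) ^+ (n + n).
Proof.
move=> xK; have mx : measurable [set x] by exact: measurable_set1.
have lo := l2_unit Go; pose u := P [set x] (unit_vec R o).
have Ru : spectral_range G P [set x] u := spectral_rangeP P_spec mx lo.
have lu := Ru.1; have su := S_sq lu.
have Bu : B u = (x + K) *: u.
  by rewrite /B /shifted_op (spectral_range_point P_spec adj_op_symmetric Ru) scalerDl.
have Bnu : iter n B u = (x + K) ^+ n *: u.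
  elim: (n) => [|m IH]; first by rewrite scale1r.
  by rewrite iterS IH /B shifted_opZ -/B Bu scalerA exprSr.
rewrite (spectral_massE P_spec)// -/u.
have uo : u o = dotl2 u u by rewrite -(spectral_massE P_spec)// /spectral_mass dotl2_unitl.
rewrite -(dotl2_iter_unit degD wtW W_ge0 _ Go).
set f := iter n B (unit_vec R o).
have lf : l2 G f by exact: iter_stable B_sym _ _ lo.
have cs := dotl2_cauchy_schwarz (S_sq lf) su.
have fu : dotl2 f u = (x + K) ^+ n * dotl2 u u.
  rewrite /f (iter_sym B_sym)// Bnu dotl2_unitl -uo.
  by [].
have [->|u0] := eqVneq (dotl2 u u) 0.
  by apply: divr_ge0; [exact/dotl2_ge0/S_sq|exact/exprn_ge0/ltW].
have upos : 0 < dotl2 u u by rewrite lt_neqAle eq_sym u0 dotl2_ge0.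
rewrite ler_pdivlMr ?exprn_gt0// -(ler_pM2r upos).
apply: le_trans cs; rewrite fu exprMn exprD expr2.
by rewrite le_eqVlt; apply/orP; left; apply/eqP; lra.
Qed.

End SpectralWalks.

(** * Continuity of walk weights in the local topology *)

Section LocalMap.
Context {R : realType}.
Variables (G H : wgraph R) (X Y : set nat) (phi : nat -> nat).
Hypothesis phi_bij : set_bij X Y phi.
Hypothesis phi_adj : forall x y, X x -> X y -> adj H (phi x) (phi y) = adj G x y.

Lemma set_bij_eq x y : X x -> X y -> (phi x == phi y) = (x == y).
Proof.
move=> Xx Xy; case: phi_bij => _ inj _; apply/eqP/eqP => [|->//].
by apply: inj; rewrite inE.
Qed.

(** Used both for isomorphisms, with [X] and [Y] the vertex sets, and for maps between balls. The
    two inclusions ensure that no neighbour is lost on either side. *)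
Lemma adj_op_map (psi : nat -> R) v : X v ->
  (forall z, adj G v z -> X z) -> (forall z, adj H (phi v) z -> Y z) ->
  adj_op H psi (phi v) = \sum_(z <- nbrs G v) wt H (phi v) (phi z) * psi (phi z).
Proof.
move=> Xv GX HY; rewrite adj_opE.
rewrite -(big_map phi xpredT (fun z => wt H (phi v) z * psi z)).
apply: perm_big; apply: uniq_perm; first exact: fset_uniq.
  rewrite map_inj_in_uniq ?fset_uniq// => a b; rewrite !in_nbrs => /GX Xa /GX Xb.
  by move/eqP; rewrite set_bij_eq// => /eqP.
move=> z; rewrite in_nbrs; apply/idP/mapP => [vz|[t + ->]].
  case: phi_bij => _ _ /(_ _ (HY _ vz))[t Xt tz]; exists t => //.
  by rewrite in_nbrs -phi_adj// tz.
by rewrite in_nbrs => vt; rewrite phi_adj//; exact: GX.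
Qed.

End LocalMap.

Lemma walk_weight_iso (R : realType) (k : nat) (G H : rooted_graph R k) c n i :
  rooted_iso G H -> walk_weight G c n (root_of G i) (root_of G i) =
  walk_weight H c n (root_of H i) (root_of H i).
Proof.
move=> [phi [bij phir phia phiw]].
have rV : vset G (root_of G i) by apply: set_mem; exact: valP.
suff h v : vset G v -> walk_weight G c n (root_of G i) v =
    walk_weight H c n (root_of H i) (phi v) by rewrite h// phir.
elim: n v => [|n IH] v Gv.
  by rewrite /walk_weight/= /unit_vec -phir (set_bij_eq bij).
rewrite /walk_weight !iterS !shifted_opE -/(walk_weight G c n (root_of G i)) -/(walk_weight H c n (root_of H i)).
rewrite -/(walk_weight _ _ _ _ v) -/(walk_weight _ _ _ _ (phi v)) IH//; congr (_ + _).
have GX z : adj G v z -> vset G z by case/(@adj_vset _ G).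
rewrite (adj_op_map bij phia)//; last by move=> z /(@adj_vset _ H)[].
rewrite adj_opE; apply: eq_big_seq => z; rewrite in_nbrs => /GX Gz.
by rewrite phiw//; congr (_ * _); exact: IH.
Qed.

Section LocalContinuity.
Context {R : realType} (k : nat).
Implicit Types G H : rooted_graph R k.

Lemma ball_aroundS G r y z : ball_around G r y -> adj G y z -> ball_around G r.+1 z.
Proof.
move=> [i [p [pp py pr]]] yz; exists i, (rcons p z).
by split; rewrite ?last_rcons ?size_rcons// rcons_path pp py.
Qed.

Lemma ball_around_root G r i : ball_around G r (root_of G i).
Proof. by exists i, [::]. Qed.

Lemma ball_around_subset G r s : (r <= s)%N -> ball_around G r `<=` ball_around G s.
Proof. by move=> rs x [i [p [pp px pr]]]; exists i, p; split => //; exact: leq_trans rs. Qed.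

Lemma ball_around_inv G r z : ball_around G r.+1 z ->
  (exists i, z = root_of G i) \/ exists2 y, ball_around G r y & adj G y z.
Proof.
move=> [i [p]]; case: (lastP p) => [|q t] [] /=.
  by move=> _ <- _; left; exists i.
rewrite rcons_path last_rcons size_rcons => /andP[qp qt] <- qr; right.
by exists (last (root_of G i) q) => //; exists i, q.
Qed.

(** [balls_close] with its map exposed, so that a filter can range over pairs of a graph and a
    map. *)
Definition close_by (r : nat) (e : R) G H (phi : nat -> nat) : Prop :=
  [/\ set_bij (ball_around G r) (ball_around H r) phi,
      forall i, phi (root_of G i) = root_of H i,
      forall x y, ball_around G r x -> ball_around G r y ->
        adj H (phi x) (phi y) = adj G x y
    & forall x y, ball_around G r x -> ball_around G r y ->
        `|wt H (phi x) (phi y) - wt G x y| < e].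

(** Roots go to roots and edges inside the r-ball to edges, so a short path from a root has an image
    of the same length. *)
Lemma close_by_ball r e G H phi m v : close_by r e G H phi -> (m <= r)%N ->
  ball_around G m v -> ball_around H m (phi v).
Proof.
move=> [_ phir phia _]; elim: m v => [|m IH] v mr.
  move=> [i [p [_ pv]]]; rewrite leqn0 size_eq0 => /eqP p0.
  by rewrite -pv p0 /= phir; exact: ball_around_root.
move=> mv; have [[i ->]|[y my yv]] := ball_around_inv mv.
  by rewrite phir; exact: ball_around_root.
apply: (ball_aroundS (IH _ (ltnW mr) my)).
by rewrite phia//; [exact: ball_around_subset (ltnW mr) _ my|exact: ball_around_subset mr _ mv].
Qed.

Definition local_filter r G : set_system (rooted_graph R k * (nat -> nat)) :=
  filter_from [set e : R | 0 < e] (fun e => [set t | close_by r e G t.1 t.2]).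

Lemma local_filter_filter r G : Filter (local_filter r G).
Proof.
apply: filter_from_filter; first by exists 1; exact: ltr01.
move=> e1 e2 /= e10 e20; exists (Num.min e1 e2); first by rewrite /= lt_min e10.
move=> [H phi] /= [bij phir phia phiw]; split; split => // x y rx ry;
  by apply: lt_le_trans (phiw _ _ rx ry) _; rewrite ge_min lexx ?orbT.
Qed.

#[local] Instance local_filter_instance r G : Filter (local_filter r G) :=
  local_filter_filter r G.

Lemma local_filter_close r G : \forall t \near local_filter r G, close_by r 1 G t.1 t.2.
Proof. by exists 1 => //=; exact: ltr01. Qed.

Lemma wt_local_cvg r G x y : ball_around G r x -> ball_around G r y ->
  wt (graph_of t.1) (t.2 x) (t.2 y) @[t --> local_filter r G] --> wt G x y.
Proof.
move=> rx ry; apply/cvgrPdist_lt => e e0; exists e => // -[H phi] /= [_ _ _ phiw].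
by rewrite distrC phiw.
Qed.

(** Each application of B looks one step further, so v has to lie n steps inside the ball. There,
    for close graphs, the row of the image of v in H is indexed by the neighbours of v in G, and a
    finite sum passes to the limit. *)
Lemma walk_weight_local_cvg r G c n u v : (n <= r)%N ->
  ball_around G r u -> ball_around G (r - n) v ->
  walk_weight (graph_of t.1) c n (t.2 u) (t.2 v) @[t --> local_filter r G] -->
    walk_weight G c n u v.
Proof.
move=> + ru; elim: n v => [|n IH] v nr rv.
  apply: cvg_near_cst; apply: filterS (local_filter_close r G).
  move=> [H phi] /= [bij _ _ _]; rewrite subn0 in rv.
  by rewrite /walk_weight/= /unit_vec (set_bij_eq bij).
have rnv : ball_around G (r - n) v by apply: ball_around_subset rv; rewrite leq_sub2l.
have rnbr z : adj G v z -> ball_around G (r - n) z.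
  by move=> vz; rewrite -subSS subSn//; exact: ball_aroundS rv vz.
have ball_r m : ball_around G (r - m) `<=` ball_around G r.
  by apply: ball_around_subset; rewrite leq_subr.
have lim : \sum_(z <- nbrs G v) wt (graph_of t.1) (t.2 v) (t.2 z) * walk_weight (graph_of t.1) c n (t.2 u) (t.2 z)
     + c * walk_weight (graph_of t.1) c n (t.2 u) (t.2 v) @[t --> local_filter r G] -->
    walk_weight G c n.+1 u v.
  have -> : walk_weight G c n.+1 u v =
      \sum_(z <- nbrs G v) wt G v z * walk_weight G c n u z + c * walk_weight G c n u v.
    by rewrite {1}/walk_weight iterS shifted_opE adj_opE.
  apply: cvgD; last first.
    by apply: cvgM; [exact: cvg_cst|apply: IH => //; exact: ltnW].
  apply: cvg_sum_seq => z; rewrite in_nbrs => vz; apply: cvgM.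
    by apply: wt_local_cvg; [exact: ball_r rv|exact: ball_r (rnbr _ vz)].
  by apply: IH; [exact: ltnW|exact: rnbr].
apply: cvg_trans lim; apply: near_eq_cvg.
apply: filterS (local_filter_close r G) => -[H phi] /= cl.
have [bij _ phia _] := cl.
rewrite shifted_opE; congr (_ + _).
rewrite (adj_op_map bij phia)//; first exact: ball_r rv.
  by move=> z /rnbr /ball_r.
move=> z vz; apply: (@ball_around_subset _ (r - n.+1).+1); last first.
  by apply: ball_aroundS vz; apply: close_by_ball cl _ rv; exact: leq_subr.
by rewrite -subSn// subSS leq_subr.
Qed.

Lemma of_to_class G : rooted_iso G (of_class (to_class G)).
Proof.
have : to_class (of_class (to_class G)) = to_class G by rewrite /to_class /of_class reprK.
by move/eqquotP/asboolP/rooted_iso_sym.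
Qed.

Definition root_walk c n i (p : gspace R k) : R :=
  walk_weight (of_class p) c n (root_of (of_class p) i) (root_of (of_class p) i).

Lemma root_walk_to_class c n i G :
  root_walk c n i (to_class G) = walk_weight G c n (root_of G i) (root_of G i).
Proof. by symmetry; apply: walk_weight_iso; exact: of_to_class. Qed.

(** The preimage of an open interval is open in the local topology: the ball of radius n determines
    the closed n-step walks at the root. *)
Lemma root_walk_measurable c n i : measurable_fun setT (root_walk c n i).
Proof.
apply: (measurability _ (RGenOpens.measurableE R)) => _ [_ [a [b ->] <-]].
set U := `]a, b[%classic; have oU : open U by exact: interval_open.
rewrite setTI; apply: sub_sigma_algebra => G /=; rewrite root_walk_to_class => GU.
have /(_ _ _ _)/= := @walk_weight_local_cvg n G c n (root_of G i) (root_of G i) (leqnn n).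
move=> /(_ (ball_around_root _ _ _) (ball_around_root _ _ _)) lim.
have /lim[e /= e0 eO] : nbhs (walk_weight G c n (root_of G i) (root_of G i)) U.
  exact: open_nbhs_nbhs.
exists n, e => // H [phi cl].
rewrite root_walk_to_class; have := eO (H, phi) cl.
by case: cl => _ phir _ _ /=; rewrite !phir.
Qed.

End LocalContinuity.

(** * Mass transport *)

Section LowerIntegral.
Context d (T : measurableType d) (R : realType).
Variable mu : {measure set T -> \bar R}.
Local Open Scope ereal_scope.
Import HBNNSimple.

(* The integral of a nonnegative function is a supremum over simple functions,
   so no measurability is needed: a simple function below f can be cut off on
   the null set where f <= g fails. *)
Lemma ge0_ae_le_integral_nonmeasurable (f g : T -> \bar R) :
  (forall x, 0 <= f x) -> (forall x, 0 <= g x) ->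
  {ae mu, forall x, f x <= g x} -> \int[mu]_x f x <= \int[mu]_x g x.
Proof.
move=> f0 g0 [N [mN muN sN]].
rewrite [leLHS]ge0_integralTE//; apply: ge_ereal_sup => _ /= [h hf <-].
have mC := measurableC mN.
pose h' := proj_nnsfun h mC.
have h'E x : h' x = (h x * \1_(~` N) x)%R by [].
have -> : sintegral mu h = sintegral mu h'.
  rewrite -!integralT_nnsfun; apply: ge0_ae_eq_integral => //.
  - exact/measurable_EFinP.
  - exact/measurable_EFinP.
  - by move=> x _; rewrite lee_fin.
  - by move=> x _; rewrite lee_fin.
  exists N; split => // x /= /not_implyP[_ hh]; apply: contrapT => Nx; apply: hh.
  have := h'E x; rewrite indicE mem_set// mulr1 => hx; congr EFin; exact: esym hx.
rewrite ge0_integralTE//; apply: ereal_sup_ubound; exists h' => // x; change ((h' x)%:E <= g x).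
rewrite h'E indicE; have [Nx|Nx] := pselect (N x).
  by rewrite memNset ?mulr0//= => /(_ Nx).
rewrite mem_set// mulr1; apply: le_trans (hf x) _.
by apply: contrapT => nfg; exact/Nx/sN.
Qed.

Lemma ae0_integral_nonmeasurable (f : T -> \bar R) :
  {ae mu, forall x, f x = 0} -> \int[mu]_x f x = 0.
Proof.
move=> f0; rewrite integralE.
have ge0_eq0 (h : T -> \bar R) : (forall x, 0 <= h x) ->
    {ae mu, forall x, h x <= 0} -> \int[mu]_x h x = 0.
  move=> h0 hle; apply/eqP; rewrite eq_le integral_ge0// andbT.
  rewrite -(integral0 mu setT).
  exact: ge0_ae_le_integral_nonmeasurable.
rewrite !ge0_eq0 ?sube0//.
- by apply: filterS f0 => x f0; rewrite funenegE f0 oppe0 maxxx.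
- by apply: filterS f0 => x f0; rewrite funeposE f0 maxxx.
Qed.

Lemma ge0_integral_eq0_ae (f : T -> \bar R) : measurable_fun setT f ->
  (forall x, 0 <= f x) -> \int[mu]_x f x <= 0 -> {ae mu, forall x, f x = 0}.
Proof.
move=> mf f0 le0.
have : \int[mu]_x `|f x| = 0.
  under eq_integral do rewrite gee0_abs//.
  by apply/eqP; rewrite eq_le le0 integral_ge0.
by move/(ae_eq_integral_abs mu measurableT mf); apply: filterS => x; exact.
Qed.

(** The form in which infinitude of the graph is used: t distinct vertices give the multiple by
    t. *)
Lemma ge0_bounded_multiples_ae0 (f : T -> \bar R) : measurable_fun setT f ->
  (forall x, 0 <= f x) -> (forall t : nat, t%:R%:E * (\int[mu]_x f x) <= 1) ->
  {ae mu, forall x, f x = 0}.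
Proof.
move=> mf f0 tle1; apply: ge0_integral_eq0_ae => //.
have : 0 <= \int[mu]_x f x by exact: integral_ge0.
case: (\int[mu]_x f x) tle1 => [r| |] tle1 r0 //; last first.
  by have := tle1 1%N; rewrite mul1e.
rewrite lee_fin in r0 *; rewrite leNgt; apply/negP => rpos.
have := tle1 (Num.truncn r^-1).+1; rewrite -EFinM lee_fin leNgt => /negP; apply.
by rewrite -ltr_pdivrMr// mul1r truncnS_gt.
Qed.

End LowerIntegral.

Lemma infinite_setT_vset (T : choiceType) (V : set T) : infinite_set V ->
  infinite_set [set: V].
Proof.
move=> infV finT; apply: infV.
rewrite (_ : V = val @` [set: V]); first exact: finite_image.
apply/seteqP; split => [x Vx|_ [x _ <-]]; last by apply: set_mem; exact: valP.
by exists (exist _ x (mem_set Vx)).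
Qed.

(** * The diagonal of the top kernel as a function on rooted graphs *)

Section TopLimit.
Context {R : realType}.

(** L(v,v), extended to every graph: the upper limit is measurable whether or not the sequence
    converges, and the maximum with 0 gives the nonnegativity that mass transport requires even
    outside the almost sure event. *)
Definition top_limit (c y : R) (G : wgraph R) (v : nat) : \bar R :=
  maxe 0%E (limn_esup (fun n => (walk_weight G c n v v / y ^+ n)%:E)).

Lemma top_limit_ge0 c y G v : (0 <= top_limit c y G v)%E.
Proof. by rewrite /top_limit le_max lexx. Qed.

Lemma top_limit_measurable (k : nat) (c y : R) (i : 'I_k) :
  measurable_fun [set: gspace R k]
    (fun p => top_limit c y (of_class p) (root_of (of_class p) i)).
Proof.
apply: measurable_maxe; first exact: measurable_cst.
apply: measurable_fun_limn_esup => n; apply/measurable_EFinP.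
by apply: measurable_funM; [exact: root_walk_measurable|exact: measurable_cst].
Qed.

Lemma top_limit_to_class (k : nat) (c y : R) (i : 'I_k) (G : rooted_graph R k) :
  top_limit c y (of_class (to_class G)) (root_of (of_class (to_class G)) i) =
  top_limit c y G (root_of G i).
Proof.
rewrite /top_limit; congr (maxe _ (limn_esup _)); apply/funext => n.
by rewrite (walk_weight_iso _ _ _ (of_to_class G)).
Qed.

Variables (G : wgraph R) (D : nat) (W : R).
Hypothesis degD : forall x, vset G x -> (degree G x <= D)%N.
Hypothesis wtW : forall x y, adj G x y -> 0 < wt G x y <= W.
Hypothesis W_ge0 : 0 <= W.
Let K := D%:R * W.
Variables (y : R) (o : nat).
Hypothesis y_gt0 : 0 < y.
Hypothesis o_vset : vset G o.
Hypothesis walk_le : forall n, walk_weight G K (n + n) o o <= y ^+ (n + n).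

Lemma top_limitE v : vset G v ->
  top_limit K y G v = (top_kernel G D W y v v)%:E.
Proof.
move=> Gv.
have c := top_kernel_cvg degD wtW W_ge0 y_gt0 o_vset walk_le (z := v) Gv.
have cE : (walk_weight G K n v v / y ^+ n)%:E @[n --> \oo] -->
  (top_kernel G D W y v v)%:E by apply: cvg_EFin => //; exact: nearW.
rewrite /top_limit is_cvg_limn_esupE; last by apply/cvg_ex; eexists; exact: cE.
rewrite (cvg_lim _ cE)//; apply/max_idPr; rewrite lee_fin.
exact: (top_kernel_ge0 degD wtW W_ge0 y_gt0 o_vset walk_le).
Qed.

Lemma esum_top_limit_le1 :
  (\esum_(v in [set: vset G]) top_limit K y G (val v) <= 1)%E.
Proof.
apply: ub_ereal_sup => _ [X [finX _] <-]; rewrite fsbig_finite//=.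
rewrite (eq_bigr (fun v : vset G => (top_kernel G D W y (val v) (val v))%:E)); last first.
  by move=> v _; rewrite top_limitE//; apply: set_mem; exact: valP.
rewrite sumEFin lee_fin -(big_map val xpredT (fun v => top_kernel G D W y v v)).
apply: (top_kernel_sum_le1 degD wtW W_ge0 y_gt0 o_vset walk_le o_vset).
  by rewrite map_inj_uniq ?fset_uniq//; exact: val_inj.
by move=> _ /mapP[v _ ->]; apply: set_mem; exact: valP.
Qed.

Lemma esum_top_limit_cst (t : nat) : infinite_set (vset G) ->
  (t%:R%:E * top_limit K y G o <= \esum_(v in [set: vset G]) top_limit K y G o)%E.
Proof.
move=> /infinite_setT_vset /(infinite_set_fset t)[X _ tX].
apply: esum_ge; exists [set` X]; first by split => //; exact: finite_fset.
rewrite fsbig_finite//= set_fsetK top_limitE//.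
rewrite sumEFin -EFinM lee_fin big_const_seq count_predT iter_addr_0 -[leRHS]mulr_natl.
rewrite ler_wpM2r ?ler_nat//.
exact: (top_kernel_ge0 degD wtW W_ge0 y_gt0 o_vset walk_le).
Qed.

Lemma spectral_mass_le_top_limit (P : set R -> (nat -> R) -> (nat -> R)) (x : R) :
  is_spectral_measure G P -> y = x + K ->
  ((spectral_mass P (unit_vec R o) [set x])%:E <= top_limit K y G o)%E.
Proof.
move=> P_spec yE; rewrite top_limitE// lee_fin.
have dbl : (n + n)%N @[n --> \oo] --> \oo.
  by move=> A [N _ NA]; exists N => // n /= Nn; apply: NA; exact: leq_trans (leq_addr _ _).
have c := cvg_comp _ _ dbl
  (top_kernel_cvg degD wtW W_ge0 y_gt0 o_vset walk_le (z := o) o_vset).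
apply: (cvgr_to_ge c); apply: nearW => n /=; rewrite yE.
by apply: (spectral_mass_point_le P_spec degD wtW W_ge0) => //; rewrite -/K -yE.
Qed.

End TopLimit.

Lemma spectral_projP (R : realType) :
  (exists P : wgraph R -> set R -> (nat -> R) -> (nat -> R),
    forall G, bounded_adj_op G -> is_spectral_measure G (P G)) ->
  forall G, bounded_adj_op G -> is_spectral_measure G (@spectral_proj R G).
Proof. by move=> exP; exact: (xgetPex _ exP). Qed.

(** * Almost sure bounds and mass transport for the random graph *)

Section TopIsNotAtom.
Context (R : realType) (d : measure_display) (Omega : measurableType d).
Variables (Pr : probability Omega R) (g : {mfun Omega >-> gspace R 1}).
Let G w := of_class (g w).
Let o w := val (the_root (G w)).
Variables (D : nat) (W : R).
Let K := D%:R * W.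
Hypothesis D_gt0 : (0 < D)%N.
Hypothesis W_gt0 : 0 < W.
Hypothesis g_unimodular : unimodular Pr g.
Hypothesis g_infinite : {ae Pr, forall w, infinite_set (vset (G w))}.
Hypothesis g_degree : {ae Pr, forall w, forall v, vset (G w) v -> (degree (G w) v <= D)%N}.
Hypothesis g_weight : {ae Pr, forall w, forall u v, adj (G w) u v -> 0 < wt (G w) u v <= W}.
Hypothesis projP : forall H, bounded_adj_op H -> is_spectral_measure H (@spectral_proj R H).
Variable x : R.
Hypothesis x_gt0 : 0 < x.
Hypothesis mu_gt_x : spectral_dist Pr g `]x, +oo[ = 0%E.
Let y := x + K.

Let W_ge0 : 0 <= W := ltW W_gt0.
Let K_gt0 : 0 < K. Proof. by rewrite mulr_gt0 ?ltr0n. Qed.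
Let y_gt0 : 0 < y. Proof. by rewrite addr_gt0. Qed.
Let o_vset w : vset (G w) (o w). Proof. by apply: set_mem; exact: valP. Qed.

Let g_spectral : {ae Pr, forall w, is_spectral_measure (G w) (spectral_proj (G w))}.
Proof.
move: g_degree; apply: filterS2 g_weight => w wtW degD; apply: projP.
exact: graph_bounded_adj_op degD wtW W_ge0.
Qed.

(** That the mass [f] vanishes almost surely cannot be read off its integral without measurability.
    Instead, [walk_weight_le_mass] bounds from above by [f] the measurable function [h], the
    rescaled excess of the walk weight over y^(2n); it is [h] that vanishes almost surely. *)
Lemma walk_weight_le_ae :
  {ae Pr, forall w, forall n, walk_weight (G w) K (n + n) (o w) (o w) <= y ^+ (n + n)}.
Proof.
apply: ae_foralln => n.
pose f w : \bar R := (dotl2 (unit_vec R (o w))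
  (spectral_proj (G w) `]x, +oo[%classic (unit_vec R (o w))))%:E.
have f0 : ((\int[Pr]_w f w) = 0)%E by exact: mu_gt_x.
have ae_mass : {ae Pr, forall w, 0 <= f w}%E.
  apply: filterS g_spectral => w P_spec; rewrite lee_fin.
  apply: (spectral_mass_ge0 P_spec); first exact: measurable_itv.
  exact/l2_unit/o_vset.
(* [f] is nonnegative only almost everywhere, while the comparison of integrals asks for it
   everywhere; hence the passage to the positive part. *)
have fp0 : ((\int[Pr]_w f^\+ w) <= 0)%E.
  have fn0 : ((\int[Pr]_w f^\- w) = 0)%E.
    apply: ae0_integral_nonmeasurable; apply: filterS ae_mass => w fw.
    by rewrite funenegE; apply/max_idPr; rewrite oppe_le0.
  by rewrite -f0 [leRHS]integralE fn0 sube0.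
(* The coefficient of the mass in [walk_weight_le_mass]; dividing by it is where [K > 0] matters. *)
pose a := ((2 * K) ^+ n) ^+ 2.
have a0 : 0 < a by rewrite !exprn_gt0// mulr_gt0.
pose h w : \bar R :=
  (Num.max 0 ((root_walk K (n + n) ord0 (g w) - y ^+ (n + n)) / a))%:E.
have mh : measurable_fun setT h.
  apply/measurable_EFinP; apply: measurable_maxr; first exact: measurable_cst.
  apply: measurable_funM; last exact: measurable_cst.
  apply: measurable_funB; last exact: measurable_cst.
  exact: measurableT_comp (root_walk_measurable _ _ _) (measurable_funPT g).
have h0 w : (0 <= h w)%E by rewrite lee_fin le_max lexx.
have hle0 : ((\int[Pr]_w h w) <= 0)%E.
  apply: le_trans fp0; apply: ge0_ae_le_integral_nonmeasurable => //.
  near=> w.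
  have degD : forall v, vset (G w) v -> (degree (G w) v <= D)%N by near: w.
  have wtW : forall u v, adj (G w) u v -> 0 < wt (G w) u v <= W by near: w.
  have P_spec : is_spectral_measure (G w) (spectral_proj (G w)) by near: w.
  have fw : (0 <= f w)%E by near: w.
  have -> : (f^\+ w = f w)%E by rewrite funeposE; apply/max_idPl.
  rewrite lee_fin ge_max -lee_fin fw/= ler_pdivrMr// lerBlDr mulrC.
  rewrite (_ : y ^+ (n + n) = (y ^+ n) ^+ 2); last by rewrite exprD expr2.
  exact: (walk_weight_le_mass P_spec degD wtW W_ge0 (o_vset w) n (ltW x_gt0)).
have := ge0_integral_eq0_ae mh h0 hle0; apply: filterS => w /eqP.
rewrite eqe => /eqP hw; have ai : 0 < a^-1 by rewrite invr_gt0.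
rewrite -subr_le0 -(pmulr_lle0 _ ai).
by rewrite -[leRHS]hw le_max lexx orbT.
Unshelve. all: by end_near. Qed.

Let h w := top_limit K y (G w) (o w).

Let h_measurable : measurable_fun setT h.
Proof.
exact: measurableT_comp (top_limit_measurable K y (ord0 : 'I_1)) (measurable_funPT g).
Qed.

Lemma integral_sum_top_limit_le1 :
  ((\int[Pr]_w \esum_(v in [set: vset (G w)]) top_limit K y (G w) (val v)) <= 1)%E.
Proof.
apply: (@le_trans _ _ (\int[Pr]_w cst 1%E w)%E); last first.
  by rewrite integral_cst// mul1e; exact: probability_le1.
apply: ge0_ae_le_integral_nonmeasurable => //.
  by move=> w; apply: esum_ge0 => v _; exact: top_limit_ge0.
near=> w.
have degD : forall v, vset (G w) v -> (degree (G w) v <= D)%N by near: w.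
have wtW : forall u v, adj (G w) u v -> 0 < wt (G w) u v <= W by near: w.
apply: (esum_top_limit_le1 degD wtW W_ge0 y_gt0 (o_vset w)).
by near: w; exact: walk_weight_le_ae.
Unshelve. all: by end_near. Qed.

Lemma integral_top_limit_le_sum (t : nat) :
  (t%:R%:E * (\int[Pr]_w h w) <= \int[Pr]_w \esum_(v in [set: vset (G w)]) h w)%E.
Proof.
rewrite -ge0_integralZl//; last by move=> w _; exact: top_limit_ge0.
apply: ge0_ae_le_integral_nonmeasurable => [w|w|].
- by rewrite mule_ge0// top_limit_ge0.
- by apply: esum_ge0 => v _; exact: top_limit_ge0.
near=> w.
have degD : forall v, vset (G w) v -> (degree (G w) v <= D)%N by near: w.
have wtW : forall u v, adj (G w) u v -> 0 < wt (G w) u v <= W by near: w.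
apply: (esum_top_limit_cst degD wtW W_ge0 y_gt0 (o_vset w)).
  by near: w; exact: walk_weight_le_ae.
by near: w.
Unshelve. all: by end_near. Qed.

Lemma mass_transport_top_limit :
  ((\int[Pr]_w \esum_(v in [set: vset (G w)]) top_limit K y (G w) (val v)) =
   \int[Pr]_w \esum_(v in [set: vset (G w)]) h w)%E.
Proof.
(* The mass depends only on its target, the second root [ord_max]. *)
pose f (p : gspace R 2) := top_limit K y (of_class p) (root_of (of_class p) (ord_max : 'I_2)).
have fE (H : wgraph R) (u v : vset H) : f (to_class (rooted2 u v)) = top_limit K y H (val v).
  by rewrite /f top_limit_to_class.
have := g_unimodular (top_limit_measurable K y (ord_max : 'I_2))
  (fun p => top_limit_ge0 _ _ _ _).
rewrite [LHS](_ : _ = (\int[Pr]_w \esum_(v in [set: vset (G w)])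
    top_limit K y (G w) (val v))%E); last first.
  by apply: eq_integral => w _; apply: eq_esum => v _; exact: fE.
move=> ->; apply: eq_integral => w _; apply: eq_esum => v _; exact: fE.
Qed.

Lemma top_limit_eq0_ae : {ae Pr, forall w, h w = 0%E}.
Proof.
apply: ge0_bounded_multiples_ae0 => [|w|t].
- exact: h_measurable.
- exact: top_limit_ge0.
apply: le_trans (integral_top_limit_le_sum t) _.
rewrite -mass_transport_top_limit; exact: integral_sum_top_limit_le1.
Qed.

Lemma spectral_dist_top : spectral_dist Pr g [set x] = 0%E.
Proof.
apply: ae0_integral_nonmeasurable; near=> w.
have degD : forall v, vset (G w) v -> (degree (G w) v <= D)%N by near: w.
have wtW : forall u v, adj (G w) u v -> 0 < wt (G w) u v <= W by near: w.
have P_spec : is_spectral_measure (G w) (spectral_proj (G w)) by near: w.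
have walk_le : forall n, walk_weight (G w) K (n + n) (o w) (o w) <= y ^+ (n + n).
  by near: w; exact: walk_weight_le_ae.
have h0 : top_limit K y (G w) (o w) = 0%E by near: w; exact: top_limit_eq0_ae.
apply/eqP; rewrite eq_le; apply/andP; split.
  rewrite -h0; exact: (spectral_mass_le_top_limit degD wtW W_ge0 y_gt0 (o_vset w) walk_le P_spec).
rewrite lee_fin; apply: (spectral_mass_ge0 P_spec); first exact: measurable_set1.
exact/l2_unit/o_vset.
Unshelve. all: by end_near. Qed.

End TopIsNotAtom.

Theorem corollary1p3 (R : realType) (d : measure_display)
    (Omega : measurableType d) (Pr : probability Omega R)
    (g : {mfun Omega >-> gspace R 1})
    (g_unimodular : unimodular Pr g)
    (g_infinite : {ae Pr, forall w, infinite_set (vset (of_class (g w)))})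
    (D : nat)
    (g_degree : {ae Pr, forall w, forall x, vset (of_class (g w)) x ->
      (degree (of_class (g w)) x <= D)%N})
    (wmin wmax : R) (wmin_gt0 : 0 < wmin) (wmin_le_wmax : wmin <= wmax)
    (g_weight : {ae Pr, forall w, forall x y, adj (of_class (g w)) x y ->
      wmin <= wt (of_class (g w)) x y <= wmax})
    (x : R) (x_gt0 : 0 < x)
    (mu_gt_x : spectral_dist Pr g `]x, +oo[ = 0%E) :
  spectral_dist Pr g [set x] = 0%E.
Proof.
(* Were there no family of spectral projections, [spectral_proj] would be the
   default value 0 of [xget]; so the spectral theorem is not needed. *)
have [exP|noP] := pselect (exists P : wgraph R -> set R -> (nat -> R) -> (nat -> R),
    forall G, bounded_adj_op G -> is_spectral_measure G (P G)); last first.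
  rewrite /spectral_dist /spectral_proj xgetPN => [|P PP]; last by apply: noP; exists P.
  by apply: integral0_eq => w _ /=; rewrite dotl2C dotl20.
(* D.+1 rather than D, so that the shift D.+1 * wmax is positive. *)
apply: (@spectral_dist_top _ _ _ _ _ D.+1 wmax) => //.
- exact: lt_le_trans wmin_gt0 wmin_le_wmax.
- by apply: filterS g_degree => w degD v /degD /leqW.
- apply: filterS g_weight => w wtw u v /wtw/andP[w1 w2].
  by rewrite (lt_le_trans wmin_gt0 w1).
- exact: spectral_projP.
Qed.
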